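(* For every complex number $q$ with $|q|<1$, \begin{align*} \sum_{i,j,k\ge 0}\frac{q^{i^2+2j^2+k^2+2ij+ik+i}(1+q^{2i+2j+k})}{(q;q)_i(q^2;q^2)_j(q^2;q^2)_k}&=\frac{(-q^3,q^8,-q^{11};-q^{11})_\infty}{(q^2,q^2,q^4;q^4)_\infty}+\frac{(q^{16},q^{28},q^{44};q^{44})_\infty}{(q,q^3,q^4;q^4)_\infty},\\ \sum_{i,j,k\ge 0}\frac{q^{i^2+2j^2+k^2+2ij+ik+k}(1+q^{i+1}-q^{2i})}{(q;q)_i(q^2;q^2)_j(q^2;q^2)_k}&=q\frac{(-q^3,q^8,-q^{11};-q^{11})_\infty}{(q^2,q^2,q^4;q^4)_\infty}+q\frac{(q^{16},q^{28},q^{44};q^{44})_\infty}{(q,q^3,q^4;q^4)_\infty}. \end{align*}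
   Context: Notation: for $n\in\mathbb{Z}_{\ge 0}$, $(a;p)_n=\prod_{k=0}^{n-1}(1-ap^k)$; for $|p|<1$, $(a;p)_\infty=\prod_{k=0}^\infty(1-ap^k)$; and $(a_1,\dots,a_m;p)_n=(a_1;p)_n\cdots(a_m;p)_n$ for $n\in\mathbb{Z}_{\ge0}\cup\{\infty\}$ (the base $p$ may be negative, e.g. $p=-q^{11}$). Sums are over nonnegative integers. *)

(* Defs.v *)
From Stdlib Require Import Reals List.
From Coquelicot Require Import Coquelicot.
Import ListNotations.
Open Scope C_scope.

Fixpoint qpoch (a p : C) (n : nat) : C :=
  match n with
  | 0%nat => 1
  | S m => qpoch a p m * (1 - a * p ^ m)
  end.

(* [lim] is total; by [qpoch_inf_unique] it is the limit of the partial
   products whenever they converge, as they do for [Cmod p < 1]. *)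
Definition qpoch_inf (a p : C) : C :=
  lim (T := C_R_CompleteNormedModule) (filtermap (qpoch a p) eventually).

Lemma qpoch_inf_unique (a p l : C) :
  filterlim (qpoch a p) eventually (locally l) -> qpoch_inf a p = l.
Proof.
intros Hl.
assert (Hb : forall eps : posreal, filtermap (qpoch a p) eventually
               (@ball C_R_CompleteNormedModule (qpoch_inf a p) eps)).
{ apply (complete_cauchy (T := C_R_CompleteNormedModule)).
  - apply filtermap_proper_filter, eventually_filter.
  - intros eps; exists l; apply Hl; exists eps; easy. }
apply (filterlim_locally_unique (K := R_AbsRing) (V := C_R_NormedModule)
         (F := eventually) (qpoch a p)).
- intros P [eps HP].
  destruct (Hb eps) as [N HN]; exists N; intros n Hn; apply HP, HN, Hn.
- exact Hl.
Qed.

(* (a_1, ..., a_m; p)_oo is written [qpochs_inf [a_1; ...; a_m] p]. *)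
Definition qpochs_inf (l : list C) (p : C) : C :=
  fold_right Cmult 1 (map (fun a => qpoch_inf a p) l).

(* Finite subsets of [A] are represented by duplicate-free lists, directed by
   inclusion. *)
Definition finite_subsets (A : Type) (P : list A -> Prop) : Prop :=
  exists F0 : list A, forall F : list A, NoDup F -> incl F0 F -> P F.

(* Unordered summation over the index type, which for complex terms amounts to
   absolute convergence. *)
Definition has_sum {A : Type} (f : A -> C) (l : C) : Prop :=
  filterlim (fun F : list A => fold_right Cplus 0 (map f F))
    (finite_subsets A) (locally l).

(* Main.v *)
Require Import Defs.
From Stdlib Require Import Reals List.
From Coquelicot Require Import Coquelicot.
From Stdlib Require Import ZArith Lia Lra Classical_Prop.
Import ListNotations.
Open Scope C_scope.

(** The k-sum of each triple sum is an instance of Euler's expansion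
    [sum_k q^(k^2+ck) / (q^2;q^2)_k = (-q^(c+1);q^2)_oo].  After splitting the
    terms by the parity of i, this product is [(-q;q^2)_oo] or [(-q^2;q^2)_oo]
    divided by a finite product, and the coefficient of each of the two
    infinite products is, with Q = q^2, b equal to i/2 rounded down or up, and
    N = b + j, a double sum
    [sum_N sum_b Q^(N^2+sN+b^2+sb) beta_b / (Q;Q)_(N-b)], s = 0 or 1.
    This is two steps of the Bailey chain applied to beta.

    The four sequences beta that occur are, up to constant factors, bilateral sums
    [beta_n = sum_r c_r / ((Q;Q)_(n-hr) (Q;Q)_(n+s+hr))] with theta
    coefficients c_r = y^r p^(r(r-1)/2).  Such sums satisfy contiguity
    relations in y (from 1/(Q;Q)_(m-1) = (1-Q^m)/(Q;Q)_m) together with a shift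
    and a reflection r -> -r, which send y to yp and to p/y.  Playing these
    against each other forces some sums to be equal to their own opposite and
    hence to vanish; what is left is a first-order recurrence, which gives the
    closed forms [bailey_C_rel_1], [bailey_C_rel_Q], [bailey_G_rel_1] and
    [bailey_G_rel_Q].  A step of the chain ([tsum_chain], from the
    q-Vandermonde sum) turns theta coefficients into theta coefficients, so
    after two steps a theta series in r is left, and Jacobi's triple product
    ([jacobi_triple]) sums it.

    All of this is done for finite sums.  The summand is multiplied by a weight
    depending on L which tends to 1 and for which the L-th sum is finite and
    equal, up to finite products, to [tsum] of level L ([shape_sum]); Tannery's theorem
    ([tannery_sum], [tannery_limit]) then lets L tend to infinity.  Powers with
    negative exponents require q <> 0; for q = 0 at most the term
    i = j = k = 0 is nonzero. *)

(** * Finite sums over lists *)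

(** The sum of [f] over a list; up to conversion, the partial sums in
    [has_sum]. *)
Definition lsum {A : Type} (F : list A) (f : A -> C) : C :=
  fold_right Cplus 0 (map f F).

Lemma lsum_cons {A} (a : A) F f : lsum (a :: F) f = f a + lsum F f.
Proof. reflexivity. Qed.

Lemma lsum_ext {A} (F : list A) (f g : A -> C) :
  (forall x, In x F -> f x = g x) -> lsum F f = lsum F g.
Proof.
intros H; unfold lsum; f_equal; apply map_ext_in, H.
Qed.

Lemma lsum_app {A} (F G : list A) (f : A -> C) : lsum (F ++ G) f = lsum F f + lsum G f.
Proof.
induction F as [|a F IH]; simpl.
- unfold lsum at 2; simpl; ring.
- rewrite !lsum_cons, IH; ring.
Qed.

Lemma lsum_plus {A} (F : list A) (f g : A -> C) :
  lsum F (fun x => f x + g x) = lsum F f + lsum F g.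
Proof.
induction F as [|a F IH]; [unfold lsum; simpl; ring|].
rewrite !lsum_cons, IH; ring.
Qed.

Lemma lsum_scal {A} (F : list A) (c : C) (f : A -> C) :
  lsum F (fun x => c * f x) = c * lsum F f.
Proof.
induction F as [|a F IH]; [unfold lsum; simpl; ring|].
rewrite !lsum_cons, IH; ring.
Qed.

Lemma lsum_sub_scal {A} (F : list A) (c : C) (f g : A -> C) :
  lsum F f - c * lsum F g = lsum F (fun x => f x - c * g x).
Proof.
induction F as [|a F IH]; [unfold lsum; simpl; ring|].
rewrite !lsum_cons, <- IH; ring.
Qed.

Lemma lsum_zero {A} (F : list A) (f : A -> C) :
  (forall x, In x F -> f x = 0) -> lsum F f = 0.
Proof.
induction F as [|a F IH]; intros H; [reflexivity|].
rewrite lsum_cons, IH, (H a); [ring|now left|intros x Hx; apply H; now right].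
Qed.

Lemma lsum_map {A B} (F : list A) (g : A -> B) f :
  lsum (map g F) f = lsum F (fun x => f (g x)).
Proof. unfold lsum; now rewrite map_map. Qed.

Lemma lsum_swap {A B} (F : list A) (G : list B) f :
  lsum F (fun x => lsum G (fun y => f x y)) =
  lsum G (fun y => lsum F (fun x => f x y)).
Proof.
induction F as [|a F IH].
- unfold lsum at 1; simpl; symmetry; now apply lsum_zero.
- rewrite lsum_cons, IH, <- lsum_plus; apply lsum_ext; intros y _.
  now rewrite lsum_cons.
Qed.

Lemma lsum_incl {A} (F G : list A) (f : A -> C) :
  NoDup F -> NoDup G -> incl F G ->
  (forall x, In x G -> ~ In x F -> f x = 0) -> lsum F f = lsum G f.
Proof.
revert G; induction F as [|a F IH]; intros G HF HG Hi H0.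
- symmetry; apply lsum_zero; intros x Hx; apply H0; auto.
- inversion HF as [|a' F' Ha HF']; subst.
  destruct (in_split a G) as [G1 [G2 ->]]; [apply Hi; now left|].
  assert (Ha' := NoDup_remove_2 _ _ _ HG).
  rewrite lsum_app, !lsum_cons, (IH (G1 ++ G2)), lsum_app; trivial.
  + ring.
  + now apply NoDup_remove_1 in HG.
  + intros x Hx.
    assert (Hx' : In x (G1 ++ a :: G2)) by (apply Hi; now right).
    apply in_app_or in Hx'; apply in_or_app; destruct Hx' as [?|[->|?]]; tauto.
  + intros x Hx Hn; apply H0.
    * apply in_app_or in Hx; apply in_or_app; simpl; tauto.
    * intros [->|?]; [|tauto].
      tauto.
Qed.

Section Union.
Context {A : Type} (dec : forall x y : A, {x = y} + {x <> y}).

Lemma lsum_supp (F G : list A) (f : A -> C) :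
  NoDup F -> NoDup G ->
  (forall x, In x F -> ~ In x G -> f x = 0) ->
  (forall x, In x G -> ~ In x F -> f x = 0) -> lsum F f = lsum G f.
Proof.
intros HF HG H1 H2.
transitivity (lsum (nodup dec (F ++ G)) f).
- apply lsum_incl; trivial; [apply NoDup_nodup| |].
  + intros x Hx; apply nodup_In, in_or_app; now left.
  + intros x Hx Hn; apply nodup_In, in_app_or in Hx; destruct Hx; auto; tauto.
- symmetry; apply lsum_incl; trivial; [apply NoDup_nodup| |].
  + intros x Hx; apply nodup_In, in_or_app; now right.
  + intros x Hx Hn; apply nodup_In, in_app_or in Hx; destruct Hx; auto; tauto.
Qed.

End Union.

(** The integers of the interval [lo, hi]; empty if hi < lo. *)
Definition zran (lo hi : Z) : list Z :=
  map (fun k => (lo + Z.of_nat k)%Z) (seq 0 (Z.to_nat (hi - lo + 1))).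

Lemma in_zran lo hi r : In r (zran lo hi) <-> (lo <= r <= hi)%Z.
Proof.
unfold zran; rewrite in_map_iff; split.
- intros [k [<- Hk]]; apply in_seq in Hk; lia.
- intros H; exists (Z.to_nat (r - lo)); split; [lia|apply in_seq; lia].
Qed.

Lemma nodup_map_inj {A B} (f : A -> B) F :
  (forall x y, f x = f y -> x = y) -> NoDup F -> NoDup (map f F).
Proof.
intros Hf HF; induction HF as [|a F Ha HF IH]; simpl; constructor; trivial.
rewrite in_map_iff; intros [x [Hx Hi]]; apply Hf in Hx; now subst.
Qed.

Lemma nodup_zran lo hi : NoDup (zran lo hi).
Proof.
apply nodup_map_inj; [intros; lia|apply seq_NoDup].
Qed.

Lemma zsum_reindex (g g' : Z -> Z) lo hi lo' hi' (f : Z -> C) :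
  (forall r, g' (g r) = r) -> (forall r, g (g' r) = r) ->
  (forall r, f r <> 0 -> (lo <= r <= hi)%Z) ->
  (forall r, f r <> 0 -> (lo' <= g' r <= hi')%Z) ->
  lsum (zran lo hi) f = lsum (zran lo' hi') (fun r => f (g r)).
Proof.
intros H1 H2 Hs Hs'.
rewrite <- (lsum_map (zran lo' hi') g f).
apply (lsum_supp Z.eq_dec).
- apply nodup_zran.
- apply nodup_map_inj; [|apply nodup_zran].
  intros x y E; rewrite <- (H1 x), <- (H1 y); congruence.
- intros x _ Hn; destruct (Ceq_dec (f x) 0) as [|Hx]; trivial.
  destruct Hn; apply in_map_iff; exists (g' x); split; auto.
  apply in_zran; auto.
- intros x _ Hn; destruct (Ceq_dec (f x) 0) as [|Hx]; trivial.
  destruct Hn; apply in_zran; auto.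
Qed.

Lemma zsum_range lo hi lo' hi' (f : Z -> C) :
  (forall r, f r <> 0 -> (lo <= r <= hi)%Z) ->
  (forall r, f r <> 0 -> (lo' <= r <= hi')%Z) ->
  lsum (zran lo hi) f = lsum (zran lo' hi') f.
Proof.
intros H H'; now rewrite (zsum_reindex (fun r => r) (fun r => r) lo hi lo' hi').
Qed.

Lemma lsum_seq_zran n (f : Z -> C) :
  lsum (seq 0 (S n)) (fun k => f (Z.of_nat k)) = lsum (zran 0 (Z.of_nat n)) f.
Proof.
unfold zran; rewrite lsum_map.
replace (Z.to_nat (Z.of_nat n - 0 + 1)) with (S n) by lia.
now apply lsum_ext.
Qed.

(** * Integer powers and theta coefficients *)

(** The power of [z] with an integer exponent, meaningful for [z <> 0]. *)
Definition zpow (z : C) (n : Z) : C :=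
  match n with
  | Z0 => 1
  | Zpos p => z ^ Pos.to_nat p
  | Zneg p => / z ^ Pos.to_nat p
  end.

Lemma zpow_nat (z : C) (n : nat) : zpow z (Z.of_nat n) = z ^ n.
Proof.
destruct n as [|n]; [reflexivity|].
change (z ^ Pos.to_nat (Pos.of_succ_nat n) = z ^ S n).
now rewrite SuccNat2Pos.id_succ.
Qed.

Lemma zpow_neg_nat (z : C) (n : nat) : zpow z (- Z.of_nat n) = / z ^ n.
Proof.
destruct n as [|n]; [simpl; field|].
change (/ z ^ Pos.to_nat (Pos.of_succ_nat n) = / z ^ S n).
now rewrite SuccNat2Pos.id_succ.
Qed.

Lemma Copp_nz (x : C) : x <> 0 -> - x <> 0.
Proof.
intros Hx E; apply Hx; replace x with (- - x) by ring; rewrite E; ring.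
Qed.

Lemma Cinv_nz (x : C) : x <> 0 -> / x <> 0.
Proof.
intros Hx E; apply C1_nz; rewrite <- (Cinv_r x Hx), E; ring.
Qed.

Lemma zpow_nz (z : C) (n : Z) : z <> 0 -> zpow z n <> 0.
Proof.
intros Hz; destruct n as [|p|p]; simpl.
- apply C1_nz.
- now apply Cpow_nz.
- now apply Cinv_nz, Cpow_nz.
Qed.

Lemma zpow_succ (z : C) (n : Z) : z <> 0 -> zpow z (n + 1) = z * zpow z n.
Proof.
intros Hz; destruct (Z_lt_le_dec n 0) as [H|H].
- replace n with (- Z.of_nat (S (Z.to_nat (-n - 1))))%Z at 2 by lia.
  replace (n + 1)%Z with (- Z.of_nat (Z.to_nat (-n - 1)))%Z by lia.
  rewrite !zpow_neg_nat, Cpow_S; field.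
  split; trivial; now apply Cpow_nz.
- replace n with (Z.of_nat (Z.to_nat n)) by lia.
  replace (Z.of_nat (Z.to_nat n) + 1)%Z with (Z.of_nat (S (Z.to_nat n))) by lia.
  rewrite !zpow_nat; apply Cpow_S.
Qed.

(** Two-sided induction over the integers. *)
Lemma Z_ind1 (P : Z -> Prop) :
  P 0%Z -> (forall n, P n <-> P (n + 1)%Z) -> forall n, P n.
Proof.
intros H0 HS n; induction n using Z.peano_ind; trivial.
- rewrite <- Z.add_1_r; now apply (HS n).
- apply (HS (Z.pred n)); now replace (Z.pred n + 1)%Z with n by lia.
Qed.

Lemma Cmult_cancel (c x y : C) : c <> 0 -> c * x = c * y -> x = y.
Proof.
intros Hc E.
replace x with (/ c * (c * x)) by (field; trivial).
rewrite E; field; trivial.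
Qed.

Lemma zpow_add (z : C) (m n : Z) : z <> 0 -> zpow z (m + n) = zpow z m * zpow z n.
Proof.
intros Hz; pattern n; apply Z_ind1; clear n.
- rewrite Z.add_0_r; simpl; ring.
- intros n; rewrite Z.add_assoc, !zpow_succ by trivial; split; intros E.
  + rewrite E; ring.
  + apply (Cmult_cancel z); trivial; rewrite E; ring.
Qed.

Lemma zpow_1 (z : C) : zpow z 1 = z.
Proof. simpl; ring. Qed.

Lemma zpow_opp (z : C) (n : Z) : z <> 0 -> zpow z (- n) = / zpow z n.
Proof.
intros Hz; apply (Cmult_cancel (zpow z n)); [now apply zpow_nz|].
rewrite <- zpow_add, Z.add_opp_diag_r by trivial; simpl.
field; now apply zpow_nz.
Qed.

Lemma zpow_mult_l (x y : C) n :
  x <> 0 -> y <> 0 -> zpow (x * y) n = zpow x n * zpow y n.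
Proof.
intros Hx Hy; assert (Hxy := Cmult_neq_0 x y Hx Hy).
pattern n; apply Z_ind1; clear n; [simpl; ring|].
intros n; rewrite !zpow_succ by trivial; split; intros E.
- rewrite E; ring.
- apply (Cmult_cancel (x * y)); trivial; rewrite E; ring.
Qed.

Lemma zpow_mul (z : C) (m n : Z) : z <> 0 -> zpow z (m * n) = zpow (zpow z m) n.
Proof.
intros Hz; assert (Hm := zpow_nz z m Hz).
pattern n; apply Z_ind1; clear n; [now rewrite Z.mul_0_r|].
intros n; rewrite Z.mul_add_distr_l, Z.mul_1_r, Z.add_comm, zpow_add,
  zpow_succ by trivial; split; intros E.
- rewrite E; ring.
- apply (Cmult_cancel (zpow z m)); trivial.
Qed.

Lemma zpow_inv (z : C) (n : Z) : z <> 0 -> zpow (/ z) n = / zpow z n.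
Proof.
intros Hz.
apply (Cmult_cancel (zpow z n)); [now apply zpow_nz|].
rewrite <- zpow_mult_l, Cinv_r, Cinv_r; trivial; [|now apply zpow_nz|now apply Cinv_nz].
pattern n; apply Z_ind1; [reflexivity|].
intros k; rewrite zpow_succ, Cmult_1_l by apply C1_nz; tauto.
Qed.

(** The triangular number r(r-1)/2. *)
Definition tri (r : Z) : Z := (r * (r - 1) / 2)%Z.

Lemma tri_spec r : (2 * tri r = r * (r - 1))%Z.
Proof.
unfold tri; symmetry.
assert (H : (r * (r - 1) mod 2 = 0)%Z).
{ destruct (Z.Even_or_Odd r) as [[k ->]|[k ->]].
  - replace (2 * k * (2 * k - 1))%Z with ((k * (2 * k - 1)) * 2)%Z by ring.
    apply Z_mod_mult.
  - replace ((2 * k + 1) * (2 * k + 1 - 1))%Z with (((2 * k + 1) * k) * 2)%Z by ring.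
    apply Z_mod_mult. }
apply Z_div_exact_full_2; lia.
Qed.

Lemma tri_succ r : (tri (r + 1) = tri r + r)%Z.
Proof. generalize (tri_spec r) (tri_spec (r + 1)); lia. Qed.

Lemma tri_opp r : (tri (- r) = tri r + r)%Z.
Proof. generalize (tri_spec r) (tri_spec (- r)); lia. Qed.

(** The general term of a theta series. *)
Definition theta (y p : C) (r : Z) : C := zpow y r * zpow p (tri r).

Lemma theta_succ (y p : C) r : y <> 0 -> p <> 0 ->
  theta y p (r + 1) = y * theta (y * p) p r.
Proof.
intros Hy Hp; unfold theta.
rewrite tri_succ, zpow_succ, zpow_add, zpow_mult_l by trivial; ring.
Qed.

Lemma theta_opp (y p : C) r : y <> 0 -> p <> 0 ->
  theta y p (- r) = theta (p / y) p r.
Proof.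
intros Hy Hp; unfold theta, Cdiv.
rewrite tri_opp, zpow_opp, zpow_add, zpow_mult_l, zpow_inv; trivial.
- ring.
- now apply Cinv_nz.
Qed.

Lemma theta_shift (y p w : C) h r : y <> 0 -> w <> 0 ->
  zpow w (h * r) * theta y p r = theta (y * zpow w h) p r.
Proof.
intros Hy Hw; unfold theta.
rewrite zpow_mult_l, zpow_mul by (trivial; now apply zpow_nz); ring.
Qed.

(** * Shifted factorials *)

Lemma Cpow_lt_1 (p : C) n : (Cmod p < 1)%R -> (Cmod (p ^ S n) < 1)%R.
Proof.
intros Hp; rewrite Cmod_pow; apply pow_lt_1_compat; [|lia].
split; trivial; apply Cmod_ge_0.
Qed.

Lemma one_minus_nz (a : C) : (Cmod a < 1)%R -> 1 - a <> 0.
Proof.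
intros Ha E; assert (E' : a = 1) by (replace a with (1 - (1 - a)) by ring; rewrite E; ring).
rewrite E', Cmod_1 in Ha; lra.
Qed.

Lemma Cmod_pow_le (p : C) n : (Cmod p <= 1)%R -> (Cmod (p ^ n) <= 1)%R.
Proof.
intros Hp; rewrite Cmod_pow, <- (pow1 n); apply pow_incr; split; trivial.
apply Cmod_ge_0.
Qed.

Lemma Cmod_mult_lt (a b : C) : (Cmod a < 1)%R -> (Cmod b <= 1)%R -> (Cmod (a * b) < 1)%R.
Proof.
intros Ha Hb; rewrite Cmod_mult.
generalize (Cmod_ge_0 a) (Cmod_ge_0 b); nra.
Qed.

Lemma qpoch_nz (a p : C) n : (Cmod a < 1)%R -> (Cmod p <= 1)%R -> qpoch a p n <> 0.
Proof.
intros Ha Hp; induction n as [|n IH]; simpl; [apply C1_nz|].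
apply Cmult_neq_0; trivial; apply one_minus_nz, Cmod_mult_lt; trivial.
now apply Cmod_pow_le.
Qed.

Lemma qpoch_cat (a p : C) m n : qpoch a p (m + n) = qpoch a p m * qpoch (a * p ^ m) p n.
Proof.
induction n as [|n IH].
- rewrite Nat.add_0_r; simpl; ring.
- rewrite Nat.add_succ_r; simpl; rewrite IH, Cpow_add_r; ring.
Qed.

(** 1/(p;p)_m, which is 0 for negative m: this convention makes the
    recurrence [ip_rec] hold for all integers m. *)
Definition ip (p : C) (m : Z) : C :=
  if (m <? 0)%Z then 0 else / qpoch p p (Z.to_nat m).

Lemma ip_neg p m : (m < 0)%Z -> ip p m = 0.
Proof. intros H; unfold ip; now rewrite (proj2 (Z.ltb_lt m 0) H). Qed.

Lemma ip_nat p n : ip p (Z.of_nat n) = / qpoch p p n.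
Proof.
unfold ip; rewrite (proj2 (Z.ltb_ge _ _)) by lia; now rewrite Nat2Z.id.
Qed.

Lemma ip_0 p : ip p 0 = 1.
Proof. unfold ip; simpl; field. Qed.

Lemma ip_nz_nonneg p m : ip p m <> 0 -> (0 <= m)%Z.
Proof.
intros H; destruct (Z_lt_le_dec m 0) as [H0|]; trivial.
now destruct H; apply ip_neg.
Qed.

Lemma qpoch_ip (p : C) n : (Cmod p < 1)%R -> qpoch p p n * ip p (Z.of_nat n) = 1.
Proof.
intros Hp; rewrite ip_nat; apply Cinv_r, qpoch_nz; lra.
Qed.

Lemma ip_rec (p : C) m : (Cmod p < 1)%R -> (1 - zpow p m) * ip p m = ip p (m - 1).
Proof.
intros Hp; destruct (Z_lt_le_dec m 1) as [H|H].
- rewrite (ip_neg p (m - 1)) by lia.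
  destruct (Z.eq_dec m 0) as [->|]; [simpl; ring|].
  rewrite ip_neg by lia; ring.
- destruct (Z_of_nat_complete (m - 1)) as [n Hn]; [lia|].
  replace (m - 1)%Z with (Z.of_nat n) by lia.
  replace m with (Z.of_nat (S n)) by lia.
  rewrite !ip_nat, zpow_nat; simpl qpoch.
  rewrite Cpow_S; field; split.
  + apply qpoch_nz; lra.
  + apply one_minus_nz; rewrite <- Cpow_S; now apply Cpow_lt_1.
Qed.

Lemma one_minus_zpow_nz (p : C) m : (Cmod p < 1)%R -> (0 < m)%Z -> 1 - zpow p m <> 0.
Proof.
intros Hp H; apply one_minus_nz.
destruct (Z_of_nat_complete (m - 1)) as [n Hn]; [lia|].
replace m with (Z.of_nat (S n)) by lia.
rewrite zpow_nat; now apply Cpow_lt_1.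
Qed.

Lemma Cmult_nz_l (a b : C) : a * b <> 0 -> a <> 0.
Proof. intros H E; apply H; rewrite E; ring. Qed.

Lemma Cmult_nz_r (a b : C) : a * b <> 0 -> b <> 0.
Proof. intros H E; apply H; rewrite E; ring. Qed.

(** From the non-vanishing of a product, the non-negativity of the indices of
    all its factors of the form [ip Q m]. *)
Ltac ip_indices H :=
  lazymatch type of H with
  | _ * _ <> _ =>
      let H1 := fresh in let H2 := fresh in
      pose proof (Cmult_nz_l _ _ H) as H1; pose proof (Cmult_nz_r _ _ H) as H2;
      clear H; ip_indices H1; ip_indices H2
  | ip _ _ <> _ => apply ip_nz_nonneg in H
  | _ => idtac
  end.

(** * Bilateral sums *)

Section Bilateral.

Variable Q : C.
Hypothesis Q0 : Q <> 0.
Hypothesis Q1 : (Cmod Q < 1)%R.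
Variable h : Z.
Hypothesis h1 : (1 <= h)%Z.

(** The sum over all integers r of [c r / ((Q;Q)_(a-hr) (Q;Q)_(b+hr))]; only
    the r with -b <= hr <= a contribute, and they lie in the interval used. *)
Definition bsum (c : Z -> C) (a b : Z) : C :=
  lsum (zran (- (Z.abs a + Z.abs b)) (Z.abs a + Z.abs b))
    (fun r => c r * (ip Q (a - h * r) * ip Q (b + h * r))).

Lemma bsum_supp (c : Z -> C) a b r :
  c r * (ip Q (a - h * r) * ip Q (b + h * r)) <> 0 ->
  (- b <= h * r <= a)%Z.
Proof.
intros H; ip_indices H; lia.
Qed.

Lemma bsum_range (c : Z -> C) a b lo hi :
  (forall r, (- b <= h * r <= a)%Z -> (lo <= r <= hi)%Z) ->
  bsum c a b =
  lsum (zran lo hi) (fun r => c r * (ip Q (a - h * r) * ip Q (b + h * r))).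
Proof.
intros H; apply zsum_range; intros r Hr; apply bsum_supp in Hr; auto.
nia.
Qed.

Lemma bsum_neg (c : Z -> C) a s : (s <= 1)%Z -> (a < 0)%Z -> bsum c a (a + s) = 0.
Proof.
intros Hs Ha; apply lsum_zero; intros r _.
destruct (Ceq_dec (c r * (ip Q (a - h * r) * ip Q (a + s + h * r))) 0) as [|H]; trivial.
apply bsum_supp in H; lia.
Qed.

Lemma bsum_ext (c c' : Z -> C) a b : (forall r, c r = c' r) -> bsum c a b = bsum c' a b.
Proof. intros H; apply lsum_ext; intros r _; now rewrite H. Qed.

Lemma bsum_scal x (c : Z -> C) a b : bsum (fun r => x * c r) a b = x * bsum c a b.
Proof.
unfold bsum; rewrite <- lsum_scal; apply lsum_ext; intros; ring.
Qed.

Lemma bsum_rec_b (c : Z -> C) a b :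
  bsum c a (b - 1) = bsum c a b - zpow Q b * bsum (fun r => zpow Q (h * r) * c r) a b.
Proof.
set (M := (Z.abs a + Z.abs b + 1)%Z).
rewrite !(fun c b' H => bsum_range c a b' (- M) M H) by (intros; nia).
rewrite lsum_sub_scal.
apply lsum_ext; intros r _.
replace (b - 1 + h * r)%Z with (b + h * r - 1)%Z by lia.
rewrite <- (ip_rec Q (b + h * r)), zpow_add by trivial; ring.
Qed.

Lemma bsum_rec_a (c : Z -> C) a b :
  bsum c (a - 1) b = bsum c a b - zpow Q a * bsum (fun r => zpow Q (h * - r) * c r) a b.
Proof.
set (M := (Z.abs a + Z.abs b + 1)%Z).
rewrite !(fun c a' H => bsum_range c a' b (- M) M H) by (intros; nia).
rewrite lsum_sub_scal.
apply lsum_ext; intros r _.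
replace (a - 1 - h * r)%Z with (a - h * r - 1)%Z by lia.
rewrite <- (ip_rec Q (a - h * r)) by trivial.
replace (a - h * r)%Z with (a + h * - r)%Z by lia.
rewrite zpow_add by trivial; ring.
Qed.

Lemma bsum_shift (c : Z -> C) a b :
  bsum c a b = bsum (fun r => c (r + 1)%Z) (a - h) (b + h).
Proof.
set (M := (Z.abs a + Z.abs b + Z.abs (a - h) + Z.abs (b + h) + 1)%Z).
rewrite !(fun c a' b' H => bsum_range c a' b' (- M) M H) by (intros; nia).
rewrite (zsum_reindex (fun r => r + 1) (fun r => r - 1) (-M) M (-M) M)%Z.
- apply lsum_ext; intros r _.
  now replace (a - h - h * r)%Z with (a - h * (r + 1))%Z by ring;
    replace (b + h + h * r)%Z with (b + h * (r + 1))%Z by ring.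
- intros; lia.
- intros; lia.
- intros r Hr; apply bsum_supp in Hr; nia.
- intros r Hr; apply bsum_supp in Hr; nia.
Qed.

Lemma bsum_refl (c : Z -> C) a b : bsum c a b = bsum (fun r => c (- r)%Z) b a.
Proof.
set (M := (Z.abs a + Z.abs b + 1)%Z).
rewrite !(fun c a' b' H => bsum_range c a' b' (- M) M H) by (intros; nia).
rewrite (zsum_reindex Z.opp Z.opp (-M) M (-M) M)%Z.
- apply lsum_ext; intros r _.
  replace (a - h * - r)%Z with (a + h * r)%Z by ring.
  replace (b + h * - r)%Z with (b - h * r)%Z by ring.
  ring.
- intros; lia.
- intros; lia.
- intros r Hr; apply bsum_supp in Hr; nia.
- intros r Hr; apply bsum_supp in Hr; nia.
Qed.

(** The bilateral sum with theta coefficients. *)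
Definition tsum (y p : C) (a b : Z) : C := bsum (theta y p) a b.

Section Rules.
Variables y p : C.
Hypothesis y0 : y <> 0.
Hypothesis p0 : p <> 0.

Lemma tsum_rec_b a b :
  tsum y p a (b - 1) = tsum y p a b - zpow Q b * tsum (y * zpow Q h) p a b.
Proof.
unfold tsum; rewrite bsum_rec_b.
rewrite (bsum_ext (fun r => zpow Q (h * r) * theta y p r) (theta (y * zpow Q h) p));
  trivial.
intros r; now apply theta_shift.
Qed.

Lemma tsum_rec_a a b :
  tsum y p (a - 1) b = tsum y p a b - zpow Q a * tsum (y / zpow Q h) p a b.
Proof.
unfold tsum; rewrite bsum_rec_a.
rewrite (bsum_ext (fun r => zpow Q (h * - r) * theta y p r) (theta (y / zpow Q h) p));
  trivial.
intros r; replace (h * - r)%Z with (- h * r)%Z by ring.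
rewrite theta_shift by trivial; unfold Cdiv; now rewrite zpow_opp.
Qed.

Lemma tsum_shift a b : tsum y p a b = y * tsum (y * p) p (a - h) (b + h).
Proof.
unfold tsum; rewrite bsum_shift, <- bsum_scal; apply bsum_ext; intros r.
now apply theta_succ.
Qed.

Lemma tsum_refl a b : tsum y p a b = tsum (p / y) p b a.
Proof.
unfold tsum; rewrite bsum_refl; apply bsum_ext; intros r.
now apply theta_opp.
Qed.

End Rules.

(** ** The q-Vandermonde sum and the Bailey chain *)

Lemma vandermonde_aux (N : nat) (v : Z) :
  lsum (zran 0 (Z.of_nat N)) (fun a =>
    zpow Q (a * (a + v)) * (ip Q (Z.of_nat N - a) * ip Q a * ip Q (a + v)))
  = ip Q (Z.of_nat N) * ip Q (Z.of_nat N + v).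
Proof.
revert v; induction N as [|N IH]; intros v.
- unfold zran, lsum; simpl; rewrite ip_0; ring.
- set (N1 := Z.of_nat (S N)).
  assert (HN : Z.of_nat N = (N1 - 1)%Z) by lia.
  rewrite HN in IH.
  apply (Cmult_cancel (1 - zpow Q N1)); [apply one_minus_zpow_nz; trivial; lia|].
  transitivity (ip Q (N1 - 1) * ip Q (N1 - 1 + v)
    + zpow Q (N1 + v) * (ip Q (N1 - 1) * ip Q (N1 - 1 + (v + 1)))).
  + rewrite <- !IH, <- !lsum_scal.
    rewrite (zsum_range 0 (N1 - 1) 0 N1 (fun a => zpow Q (a * (a + v)) * _)).
    2,3: intros r Hr; ip_indices Hr; lia.
    rewrite (zsum_reindex (fun a => (a - 1)%Z) (fun a => (a + 1)%Z) 0 (N1 - 1) 0 N1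
       (fun a => zpow Q (N1 + v) * _)).
    2,3: intros; lia.
    2,3: intros r Hr; ip_indices Hr; lia.
    rewrite <- lsum_plus; apply lsum_ext; intros a _.
    replace (N1 - 1 - a)%Z with (N1 - a - 1)%Z by lia.
    replace (N1 - 1 - (a - 1))%Z with (N1 - a)%Z by lia.
    replace (a - 1 + (v + 1))%Z with (a + v)%Z by lia.
    rewrite <- (ip_rec Q (N1 - a)), <- (ip_rec Q a) by trivial.
    assert (E1 : zpow Q N1 = zpow Q (N1 - a) * zpow Q a)
      by (rewrite <- zpow_add by trivial; f_equal; lia).
    assert (E2 : zpow Q (N1 + v) * zpow Q ((a - 1) * (a + v))
                 = zpow Q (N1 - a) * zpow Q (a * (a + v)))
      by (rewrite <- !zpow_add by trivial; f_equal; ring).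
    rewrite E1.
    transitivity (zpow Q (a * (a + v)) * ((1 - zpow Q (N1 - a)) * ip Q (N1 - a) * ip Q a * ip Q (a + v))
      + (zpow Q (N1 - a) * zpow Q (a * (a + v)))
        * (ip Q (N1 - a) * ((1 - zpow Q a) * ip Q a) * ip Q (a + v))); [ring|].
    rewrite <- E2; ring.
  + replace (N1 - 1 + v)%Z with (N1 + v - 1)%Z by lia.
    replace (N1 - 1 + (v + 1))%Z with (N1 + v)%Z by lia.
    rewrite <- !ip_rec by trivial; ring.
Qed.

(** The q-Vandermonde sum; the summand vanishes unless u <= a <= N. *)
Lemma vandermonde (N u v lo hi : Z) : (lo <= u)%Z -> (N <= hi)%Z ->
  lsum (zran lo hi) (fun a =>
    zpow Q ((a - u) * (a + v)) * (ip Q (N - a) * ip Q (a - u) * ip Q (a + v)))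
  = ip Q (N - u) * ip Q (N + v).
Proof.
intros Hlo Hhi; destruct (Z_lt_le_dec N u) as [H|H].
- rewrite (ip_neg Q (N - u)), Cmult_0_l by lia.
  apply lsum_zero; intros a _.
  destruct (Z_lt_le_dec a u).
  + rewrite (ip_neg Q (a - u)) by lia; ring.
  + rewrite (ip_neg Q (N - a)) by lia; ring.
- replace (N - u)%Z with (Z.of_nat (Z.to_nat (N - u))) by lia.
  replace (N + v)%Z with (Z.of_nat (Z.to_nat (N - u)) + (u + v))%Z by lia.
  rewrite <- vandermonde_aux, Z2Nat.id by lia.
  rewrite (zsum_reindex (fun a => a + u) (fun a => a - u) lo hi 0 (N - u))%Z.
  + apply lsum_ext; intros a _.
    replace (a + u - u)%Z with a by lia.
    replace (a + u + v)%Z with (a + (u + v))%Z by lia.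
    now replace (N - (a + u))%Z with (N - u - a)%Z by lia.
  + intros; lia.
  + intros; lia.
  + intros r Hr; ip_indices Hr; lia.
  + intros r Hr; ip_indices Hr; lia.
Qed.

(** One step of the Bailey chain, for a pair relative to Q^s.  Only s = 0 and
    s = 1 are allowed: then [bsum c a (a + s)] vanishes for negative a. *)
Lemma bailey_chain (c : Z -> C) (s N : Z) : (0 <= s <= 1)%Z ->
  lsum (zran 0 N) (fun a => zpow Q (a * a + s * a) * ip Q (N - a) * bsum c a (a + s))
  = bsum (fun r => zpow Q (h * r * (h * r + s)) * c r) N (N + s).
Proof.
intros Hs.
set (M := (2 * Z.abs N + 2)%Z).
rewrite (bsum_range _ N (N + s) (- M) M) by (intros; nia).
rewrite (lsum_ext _ _ (fun a => lsum (zran (- M) M) (fun r =>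
   c r * zpow Q (h * r * (h * r + s)) *
    (zpow Q ((a - h * r) * (a + (h * r + s))) *
     (ip Q (N - a) * ip Q (a - h * r) * ip Q (a + (h * r + s))))))).
- rewrite lsum_swap; apply lsum_ext; intros r _.
  rewrite lsum_scal.
  replace (N + s + h * r)%Z with (N + (h * r + s))%Z by ring.
  rewrite <- (vandermonde N (h * r) (h * r + s) (Z.min 0 (h * r)) N) by lia.
  rewrite (zsum_range 0 N (Z.min 0 (h * r)) N).
  + ring.
  + intros a Ha; ip_indices Ha; lia.
  + intros a Ha; ip_indices Ha; lia.
- intros a Ha; apply in_zran in Ha.
  rewrite (bsum_range _ a (a + s) (- M) M) by (intros; nia).
  rewrite <- lsum_scal; apply lsum_ext; intros r _.
  replace (a * a + s * a)%Z
    with ((a - h * r) * (a + (h * r + s)) + h * r * (h * r + s))%Z by ring.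
  replace (a + s + h * r)%Z with (a + (h * r + s))%Z by ring.
  rewrite zpow_add by trivial; ring.
Qed.

(** A Gaussian factor only changes the two parameters of the theta term, since
    r^2 = r + 2 (r(r-1)/2). *)
Lemma theta_gauss (y p : C) s r : y <> 0 -> p <> 0 ->
  zpow Q (h * r * (h * r + s)) * theta y p r
  = theta (y * zpow Q (h * (h + s))) (p * zpow Q (2 * h * h)) r.
Proof.
intros Hy Hp; unfold theta.
rewrite !zpow_mult_l, <- !zpow_mul by (trivial; now apply zpow_nz).
replace (h * r * (h * r + s))%Z
  with (h * (h + s) * r + 2 * h * h * tri r)%Z
  by (generalize (tri_spec r); nia).
rewrite zpow_add by trivial; ring.
Qed.

Lemma tsum_chain (y p : C) (s N : Z) : y <> 0 -> p <> 0 -> (0 <= s <= 1)%Z ->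
  lsum (zran 0 N) (fun a => zpow Q (a * a + s * a) * ip Q (N - a) * tsum y p a (a + s))
  = tsum (y * zpow Q (h * (h + s))) (p * zpow Q (2 * h * h)) N (N + s).
Proof.
intros Hy Hp Hs; unfold tsum; rewrite bailey_chain by trivial.
apply bsum_ext; intros r; now apply theta_gauss.
Qed.

End Bilateral.

(** Finite form of Jacobi's triple product.  For n = 0 it is the q-binomial
    theorem. *)
Lemma finite_jtp (z p : C) (m n : nat) : z <> 0 -> p <> 0 -> (Cmod p < 1)%R ->
  tsum p 1 (- z) p (Z.of_nat m) (Z.of_nat n)
  = qpoch z p m * qpoch (p / z) p n * ip p (Z.of_nat (m + n)).
Proof.
intros Hz Hp Hp1.
assert (Hz' : - z <> 0) by now apply Copp_nz.
(* Contiguity in a and in b relates the sums with parameters -z and -zp; the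
   shift closes the system, which leaves a first-order recurrence in b.
   Likewise with -z and -z/p for a. *)
assert (Hb : forall a b, (1 - zpow p (a + b)) * tsum p 1 (- z) p a b
   = (1 - zpow p b / z) * tsum p 1 (- z) p a (b - 1)).
{ intros a b.
  rewrite (tsum_rec_b p Hp Hp1 1 ltac:(lia) (- z) p Hz' a b), zpow_1.
  assert (E := tsum_rec_a p Hp Hp1 1 ltac:(lia) (- z * p) p
     (Cmult_neq_0 _ _ Hz' Hp) a b).
  rewrite zpow_1 in E.
  replace (- z * p / p) with (- z) in E by (field; trivial).
  assert (E2 := tsum_shift p 1 ltac:(lia) (- z) p Hz' Hp a (b - 1)).
  replace (b - 1 + 1)%Z with b in E2 by lia.
  rewrite E in E2.
  rewrite (tsum_rec_b p Hp Hp1 1 ltac:(lia) (- z) p Hz' a b), zpow_1 in E2.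
  rewrite zpow_add by trivial.
  set (X := tsum p 1 (- z) p a b) in *.
  set (Y := tsum p 1 (- z * p) p a b) in *.
  set (A := zpow p a) in *; set (B := zpow p b) in *.
  transitivity (X - B * Y + B / (- z) * (X - B * Y)); [|field; trivial].
  rewrite E2 at 2; field; trivial. }
assert (Ha : forall a b, (1 - zpow p (a + b)) * tsum p 1 (- z) p a b
   = (1 - z * zpow p (a - 1)) * tsum p 1 (- z) p (a - 1) b).
{ intros a b.
  rewrite (tsum_rec_a p Hp Hp1 1 ltac:(lia) (- z) p Hz' a b), zpow_1.
  assert (Hzp : - z / p <> 0) by (apply Cmult_neq_0; trivial; now apply Cinv_nz).
  assert (E := tsum_rec_b p Hp Hp1 1 ltac:(lia) (- z / p) p Hzp a b).
  rewrite zpow_1 in E.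
  replace (- z / p * p) with (- z) in E by (field; trivial).
  assert (E2 := tsum_shift p 1 ltac:(lia) (- z / p) p Hzp Hp a (b - 1)).
  replace (b - 1 + 1)%Z with b in E2 by lia.
  rewrite E in E2.
  replace (- z / p * p) with (- z) in E2 by (field; trivial).
  rewrite (tsum_rec_a p Hp Hp1 1 ltac:(lia) (- z) p Hz' a b), zpow_1 in E2.
  assert (EA : zpow p a = zpow p (a - 1) * p).
  { rewrite <- (zpow_1 p) at 3; rewrite <- zpow_add by trivial; f_equal; lia. }
  rewrite zpow_add, EA in * by trivial.
  set (X := tsum p 1 (- z) p a b) in *.
  set (Y := tsum p 1 (- z / p) p a b) in *.
  set (A := zpow p (a - 1)) in *; set (B := zpow p b) in *.
  transitivity (X - A * p * Y + A * p * (- z / p * (X - A * p * Y))); [|field; trivial].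
  rewrite <- E2; ring. }
induction n as [|n IHn].
- induction m as [|m IHm].
  + unfold tsum, bsum; simpl; unfold zran, lsum, theta; simpl; rewrite !ip_0.
    change (tri 0) with 0%Z; simpl; ring.
  + apply (Cmult_cancel (1 - zpow p (Z.of_nat (S m) + Z.of_nat 0))).
    { apply one_minus_zpow_nz; trivial; lia. }
    rewrite Ha.
    replace (Z.of_nat (S m) - 1)%Z with (Z.of_nat m) by lia.
    replace (Z.of_nat (S m) + Z.of_nat 0)%Z with (Z.of_nat (S m + 0)) by lia.
    replace (Z.of_nat (m + 0)) with (Z.of_nat (S m + 0) - 1)%Z in IHm by lia.
    rewrite IHm, <- ip_rec, zpow_nat by trivial; simpl qpoch; ring.
- apply (Cmult_cancel (1 - zpow p (Z.of_nat m + Z.of_nat (S n)))).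
  { apply one_minus_zpow_nz; trivial; lia. }
  rewrite Hb.
  replace (Z.of_nat (S n) - 1)%Z with (Z.of_nat n) by lia.
  replace (Z.of_nat m + Z.of_nat (S n))%Z with (Z.of_nat (m + S n)) by lia.
  replace (Z.of_nat (m + n)) with (Z.of_nat (m + S n) - 1)%Z in IHn by lia.
  rewrite IHn, <- ip_rec, (zpow_nat p (S n)), Cpow_S by trivial; simpl qpoch.
  field; trivial.
Qed.

(** * Bailey pairs *)

Lemma tsum_00 (Q y p : C) h : tsum Q h y p 0 0 = 1.
Proof.
unfold tsum, bsum, zran, lsum, theta; simpl.
rewrite !Z.mul_0_r; simpl; rewrite ip_0.
change (tri 0) with 0%Z; simpl; ring.
Qed.

Lemma zpow_2 (z : C) : zpow z 2 = z ^ 2.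
Proof. reflexivity. Qed.

Lemma eq_opp_0 (x : C) : x = - x -> x = 0.
Proof.
intros E; apply (Cmult_cancel 2).
- intros E2; apply (f_equal fst) in E2; simpl in E2; lra.
- transitivity (x + x); [ring|]; rewrite E at 2; ring.
Qed.

(** Bilateral sums with h = 2 and p = Q^6 (group C of Slater's list).  Below,
    [W y n n], [W y n (n + 1)] and [W y n (n + 2)] are compared for the y of the
    form -Q^k.  Reflection followed by a shift relates two sums of the last kind,
    and turns the one with y = -Q^6 into its opposite, so that this one is 0. *)
Section FamilyC.

Variable Q : C.
Hypothesis Q0 : Q <> 0.
Hypothesis Q1 : (Cmod Q < 1)%R.

Let W (y : C) (a b : Z) : C := tsum Q 2 y (Q ^ 6) a b.

Let W_b (y : C) a b : y <> 0 -> W y a (b - 1) = W y a b - zpow Q b * W (y * Q ^ 2) a b.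
Proof. intros Hy; unfold W; rewrite <- zpow_2; apply tsum_rec_b; trivial; lia. Qed.

Let W_a (y : C) a b : y <> 0 -> W y (a - 1) b = W y a b - zpow Q a * W (y / Q ^ 2) a b.
Proof. intros Hy; unfold W; rewrite <- zpow_2; apply tsum_rec_a; trivial; lia. Qed.

Let W_shift (y : C) a b : y <> 0 -> W y (a + 2) b = y * W (y * Q ^ 6) a (b + 2).
Proof.
intros Hy; unfold W; rewrite tsum_shift; trivial; [|lia|now apply Cpow_nz].
now replace (a + 2 - 2)%Z with a by lia.
Qed.

Let W_refl (y : C) a b : y <> 0 -> W y a b = W (Q ^ 6 / y) b a.
Proof. intros Hy; apply tsum_refl; trivial; [lia|now apply Cpow_nz]. Qed.

Let Qn k : Q ^ k <> 0.
Proof. now apply Cpow_nz. Qed.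

Let mQn k : - Q ^ k <> 0.
Proof. now apply Copp_nz. Qed.

Let refl2 (y : C) n : y <> 0 -> W y n (n + 2) = Q ^ 6 / y * W (Q ^ 12 / y) n (n + 2).
Proof.
intros Hy; rewrite W_refl, W_shift; trivial.
- do 2 f_equal; field; trivial.
- apply Cmult_neq_0; trivial; now apply Cinv_nz.
Qed.

Let Z3 n : W (- Q ^ 6) n (n + 2) = 0.
Proof.
apply eq_opp_0; rewrite refl2 at 1 by trivial.
replace (Q ^ 12 / - Q ^ 6) with (- Q ^ 6) by (field; trivial).
field; trivial.
Qed.

Let Y1 n : W (- Q ^ 4) n (n + 1) = W (- Q ^ 4) n (n + 2).
Proof.
replace (n + 1)%Z with (n + 2 - 1)%Z by lia; rewrite W_b by trivial.
replace (- Q ^ 4 * Q ^ 2) with (- Q ^ 6) by ring.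
rewrite Z3; ring.
Qed.

Let Y3 n : W (- Q ^ 6) n (n + 1) = zpow Q n * W (- Q ^ 4) n (n + 1).
Proof.
rewrite Y1; replace (n + 1)%Z with (n + 2 - 1)%Z by lia; rewrite W_b by trivial.
replace (- Q ^ 6 * Q ^ 2) with (- Q ^ 8) by ring.
rewrite Z3, refl2 by trivial.
replace (Q ^ 12 / - Q ^ 8) with (- Q ^ 4) by (field; trivial).
rewrite zpow_add, zpow_2 by trivial; field; trivial.
Qed.

Let X1 n : W (- Q ^ 4) n n = (1 - zpow Q (2 * n + 1)) * W (- Q ^ 4) n (n + 1).
Proof.
replace n with (n + 1 - 1)%Z at 2 by lia; rewrite W_b by trivial.
replace (- Q ^ 4 * Q ^ 2) with (- Q ^ 6) by ring.
rewrite Y3; replace (2 * n + 1)%Z with (n + 1 + n)%Z by lia.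
rewrite (zpow_add Q (n + 1) n) by trivial; ring.
Qed.

Let Xm1 n : W (- Q ^ 2) n n = W (- Q ^ 4) n n.
Proof. rewrite W_refl by trivial; f_equal; field; trivial. Qed.

Let Y1' n : W (- Q ^ 4) n (n + 1) = (1 - zpow Q (n + 1)) * W (- Q ^ 4) (n + 1) (n + 1).
Proof.
replace n with (n + 1 - 1)%Z at 1 by lia; rewrite W_a by trivial.
replace (- Q ^ 4 / Q ^ 2) with (- Q ^ 2) by (field; trivial).
rewrite Xm1; ring.
Qed.

Let Ym1 n : W (- Q ^ 2) n (n + 1)
  = W (- Q ^ 4) n n + zpow Q (n + 1) * W (- Q ^ 4) n (n + 1).
Proof.
assert (E := W_b (- Q ^ 2) n (n + 1) (mQn 2)).
replace (n + 1 - 1)%Z with n in E by lia.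
replace (- Q ^ 2 * Q ^ 2) with (- Q ^ 4) in E by ring.
rewrite <- Xm1, E; ring.
Qed.

Let Xm3 n : zpow Q (n + 1) * W (- Q ^ 6) (n + 1) (n + 1)
  = W (- Q ^ 4) (n + 1) (n + 1) - W (- Q ^ 2) n (n + 1).
Proof.
assert (E := W_a (- Q ^ 2) (n + 1) (n + 1) (mQn 2)).
replace (n + 1 - 1)%Z with n in E by lia.
rewrite E, Xm1, (W_refl (- Q ^ 6)) by trivial.
replace (Q ^ 6 / - Q ^ 6) with (- Q ^ 2 / Q ^ 2) by (field; trivial); ring.
Qed.

Let d1 n := 1 - Q * (Q ^ 2) ^ n.
Let d2 n := 1 - Q * Q ^ n.

Let d1_nz n : d1 n <> 0.
Proof.
apply one_minus_nz, Cmod_mult_lt; trivial; apply Cmod_pow_le; left.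
now apply Cpow_lt_1.
Qed.

Let d2_nz n : d2 n <> 0.
Proof. apply one_minus_nz; rewrite <- Cpow_S; now apply Cpow_lt_1. Qed.

Let den n := qpoch Q (Q ^ 2) n * qpoch Q Q n.

Let den_nz n : den n <> 0.
Proof.
assert (H := Cpow_lt_1 Q 1 Q1).
apply Cmult_neq_0; apply qpoch_nz; trivial; lra.
Qed.

Let X1_closed (n : nat) : W (- Q ^ 4) (Z.of_nat n) (Z.of_nat n) = / den n.
Proof.
induction n as [|n IH].
- unfold W, den; simpl Z.of_nat; rewrite tsum_00; simpl; field.
- rewrite X1, Y1' in IH.
  replace (Z.of_nat n + 1)%Z with (Z.of_nat (S n)) in IH by lia.
  replace (2 * Z.of_nat n + 1)%Z with (Z.of_nat (S (2 * n))) in IH by lia.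
  rewrite !zpow_nat, (Cpow_S Q n), (Cpow_S Q (2 * n)), (Cpow_mult_r Q 2 n) in IH.
  apply (Cmult_cancel (d1 n * d2 n)); [now apply Cmult_neq_0|].
  transitivity (/ den n); [rewrite <- IH; unfold d1, d2; ring|].
  replace (den (S n)) with (den n * (d1 n * d2 n))
    by (unfold den, d1, d2; simpl; ring).
  field; auto.
Qed.

Let Y1_closed (n : nat) :
  W (- Q ^ 4) (Z.of_nat n) (Z.of_nat n + 1) = / (den n * d1 n).
Proof.
apply (Cmult_cancel (d1 n)); trivial.
transitivity (/ den n); [|field; auto].
rewrite <- X1_closed, X1.
replace (2 * Z.of_nat n + 1)%Z with (Z.of_nat (S (2 * n))) by lia.
now rewrite zpow_nat, (Cpow_S Q (2 * n)), (Cpow_mult_r Q 2 n).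
Qed.

Lemma bailey_C_rel_Q (n : nat) :
  tsum Q 2 (- Q ^ 2) (Q ^ 6) (Z.of_nat n) (Z.of_nat n + 1)
  = (1 + Q ^ (n + 1) - Q ^ (2 * n + 1)) / (qpoch Q (Q ^ 2) (S n) * qpoch Q Q n).
Proof.
fold (W (- Q ^ 2) (Z.of_nat n) (Z.of_nat n + 1)).
rewrite Ym1, Y1_closed, X1_closed.
replace (Z.of_nat n + 1)%Z with (Z.of_nat (n + 1)) by lia.
replace (qpoch Q (Q ^ 2) (S n) * qpoch Q Q n) with (den n * d1 n)
  by (unfold den, d1; simpl; ring).
rewrite zpow_nat; replace (Q ^ (2 * n + 1)) with (1 - d1 n)
  by (unfold d1; rewrite Cpow_add_r, (Cpow_mult_r Q 2 n); ring).
field; auto.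
Qed.

Lemma bailey_C_rel_1 (n : nat) :
  Q * tsum Q 2 (- Q ^ 6) (Q ^ 6) (Z.of_nat n) (Z.of_nat n)
  = (Q ^ n + Q ^ (n + 1) - Q ^ (2 * n)) / (qpoch Q (Q ^ 2) n * qpoch Q Q n).
Proof.
destruct n as [|n].
- simpl Z.of_nat; rewrite tsum_00; simpl; field.
- apply (Cmult_cancel (Q ^ n)); trivial.
  replace (Z.of_nat (S n)) with (Z.of_nat n + 1)%Z by lia.
  transitivity (zpow Q (Z.of_nat n + 1) * W (- Q ^ 6) (Z.of_nat n + 1) (Z.of_nat n + 1)).
  { replace (Z.of_nat n + 1)%Z with (Z.of_nat (S n)) by lia.
    rewrite zpow_nat; unfold W; simpl Cpow; ring. }
  rewrite Xm3.
  unfold W at 2; rewrite bailey_C_rel_Q.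
  replace (Z.of_nat n + 1)%Z with (Z.of_nat (S n)) by lia.
  rewrite X1_closed.
  fold (den (S n)).
  replace (den (S n)) with (den n * (d1 n * d2 n))
    by (unfold den, d1, d2; simpl; ring).
  replace (qpoch Q (Q ^ 2) (S n) * qpoch Q Q n) with (den n * d1 n)
    by (unfold den, d1; simpl; ring).
  transitivity ((1 - (1 + Q ^ (n + 1) - Q ^ (2 * n + 1)) * d2 n)
                / (den n * (d1 n * d2 n))); [field; auto|].
  unfold Cdiv; rewrite (Cmult_assoc (Q ^ n)); apply (f_equal2 Cmult); [|reflexivity].
  replace (2 * S n)%nat with (n + n + 2)%nat by lia.
  replace (2 * n + 1)%nat with (n + n + 1)%nat by lia.
  replace (S n + 1)%nat with (n + 2)%nat by lia.
  unfold d2; rewrite !Cpow_add_r; simpl Cpow; ring.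
Qed.

End FamilyC.

(** Bilateral sums with h = 1, Q = t^2 and p = t^3 (group G of Slater's list).
    Here reflection followed by a shift already relates two sums
    [W y n (n + 1)], and shows that the one with y = -t^3 is 0. *)
Section FamilyG.

Variable t : C.
Hypothesis t0 : t <> 0.
Hypothesis t1 : (Cmod t < 1)%R.

Let Q := t ^ 2.

Let Q0 : Q <> 0.
Proof. now apply Cpow_nz. Qed.

Let Q1 : (Cmod Q < 1)%R.
Proof. now apply Cpow_lt_1. Qed.

Let W (y : C) (a b : Z) : C := tsum Q 1 y (t ^ 3) a b.

Let W_b (y : C) a b : y <> 0 -> W y a (b - 1) = W y a b - zpow Q b * W (y * t ^ 2) a b.
Proof.
intros Hy; unfold W; rewrite tsum_rec_b; trivial; [|lia].
now rewrite zpow_1.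
Qed.

Let W_a (y : C) a b : y <> 0 -> W y (a - 1) b = W y a b - zpow Q a * W (y / t ^ 2) a b.
Proof.
intros Hy; unfold W; rewrite tsum_rec_a; trivial; [|lia].
now rewrite zpow_1.
Qed.

Let tn k : t ^ k <> 0.
Proof. now apply Cpow_nz. Qed.

Let mtn k : - t ^ k <> 0.
Proof. now apply Copp_nz. Qed.

Let W_refl (y : C) a b : y <> 0 -> W y a b = W (t ^ 3 / y) b a.
Proof. intros Hy; apply tsum_refl; trivial; lia. Qed.

Let refl1 (y : C) n : y <> 0 -> W y n (n + 1) = t ^ 3 / y * W (t ^ 6 / y) n (n + 1).
Proof.
intros Hy; rewrite W_refl by trivial; unfold W at 1; rewrite tsum_shift; trivial.
- replace (n + 1 - 1)%Z with n by lia.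
  unfold W; do 2 f_equal; field; trivial.
- lia.
- apply Cmult_neq_0; trivial; now apply Cinv_nz.
Qed.

Let Y3 n : W (- t ^ 3) n (n + 1) = 0.
Proof.
apply eq_opp_0; rewrite refl1 at 1 by trivial.
replace (t ^ 6 / - t ^ 3) with (- t ^ 3) by (field; trivial).
field; trivial.
Qed.

Let X1 n : W (- t ^ 2) n n = (1 + t * zpow Q n) * W (- t ^ 2) n (n + 1).
Proof.
replace n with (n + 1 - 1)%Z at 2 by lia; rewrite W_b by trivial.
replace (- t ^ 2 * t ^ 2) with (- t ^ 4) by ring.
rewrite (refl1 (- t ^ 4)) by trivial.
replace (t ^ 6 / - t ^ 4) with (- t ^ 2) by (field; trivial).
rewrite zpow_add, zpow_1 by trivial; unfold Q; field; trivial.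
Qed.

Let Xm1 n : W (- t) n n = W (- t ^ 2) n n.
Proof.
rewrite W_refl by now apply Copp_nz.
f_equal; field; trivial.
Qed.

Let Ym1 n : W (- t) n (n + 1) = W (- t ^ 2) n n.
Proof.
rewrite <- Xm1; replace n with (n + 1 - 1)%Z at 4 by lia.
rewrite W_b by now apply Copp_nz.
replace (- t * t ^ 2) with (- t ^ 3) by ring.
rewrite Y3; ring.
Qed.

Let X3 n : W (- t ^ 3) n n = zpow Q n * W (- t ^ 2) n n.
Proof.
replace n with (n + 1 - 1)%Z at 2 by lia; rewrite W_b by trivial.
replace (- t ^ 3 * t ^ 2) with (- t ^ 5) by ring.
rewrite Y3, (refl1 (- t ^ 5)) by trivial.
replace (t ^ 6 / - t ^ 5) with (- t) by (field; trivial).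
rewrite Ym1, zpow_add, zpow_1 by trivial; unfold Q; field; trivial.
Qed.

Let Xm3 n : W (- (1)) n n = zpow Q n * W (- t ^ 2) n n.
Proof.
rewrite W_refl by apply Copp_nz, C1_nz.
rewrite <- X3; f_equal; field; apply Copp_nz, C1_nz.
Qed.

Let Y1 n : W (- t ^ 2) n (n + 1)
  = (1 - zpow Q (n + 1) * zpow Q (n + 1)) * W (- t ^ 2) (n + 1) (n + 1).
Proof.
replace n with (n + 1 - 1)%Z at 1 by lia; rewrite W_a by trivial.
replace (- t ^ 2 / t ^ 2) with (- (1)) by (field; trivial).
rewrite Xm3; ring.
Qed.

Let Ym3 n : W (- (1)) n (n + 1)
  = zpow Q n * W (- t ^ 2) n n + zpow Q (n + 1) * W (- t ^ 2) n (n + 1).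
Proof.
assert (E := W_b (- (1)) n (n + 1) (Copp_nz _ C1_nz)).
replace (n + 1 - 1)%Z with n in E by lia.
replace (- (1) * t ^ 2) with (- t ^ 2) in E by ring.
rewrite <- Xm3, E; ring.
Qed.

Let Xm5 n : zpow Q (n + 1) * W (- / t) (n + 1) (n + 1)
  = W (- t ^ 2) (n + 1) (n + 1) - W (- t ^ 2) n n.
Proof.
assert (E := W_a (- t) (n + 1) (n + 1) (Copp_nz _ t0)).
replace (n + 1 - 1)%Z with n in E by lia.
rewrite Ym1 in E; rewrite E, Xm1.
replace (- t / t ^ 2) with (- / t) by (field; trivial); ring.
Qed.

Let d1 n := 1 + t * Q ^ n.
Let d2 n := 1 - t ^ 4 * (t ^ 4) ^ n.

Let d1_nz n : d1 n <> 0.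
Proof.
replace (d1 n) with (1 - (- t) * Q ^ n) by (unfold d1; ring).
apply one_minus_nz, Cmod_mult_lt; [now rewrite Cmod_opp|].
apply Cmod_pow_le; now left.
Qed.

Let d2_nz n : d2 n <> 0.
Proof.
apply one_minus_nz; rewrite <- Cpow_S; now apply Cpow_lt_1, Cpow_lt_1.
Qed.

Let den n := qpoch (- t) Q n * qpoch (t ^ 4) (t ^ 4) n.

Let den_nz n : den n <> 0.
Proof.
assert (H := Cpow_lt_1 t 3 t1).
apply Cmult_neq_0; apply qpoch_nz; rewrite ?Cmod_opp; trivial; lra.
Qed.

Let den_S n : den (S n) = den n * (d1 n * d2 n).
Proof. unfold den, d1, d2; simpl; ring. Qed.

Let Qn2 n : Q ^ S n * Q ^ S n = t ^ 4 * (t ^ 4) ^ n.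
Proof.
rewrite <- Cpow_S; unfold Q; rewrite <- Cpow_mult_l; f_equal; ring.
Qed.

Let X1_closed (n : nat) : W (- t ^ 2) (Z.of_nat n) (Z.of_nat n) = / den n.
Proof.
induction n as [|n IH].
- unfold W, den; simpl Z.of_nat; rewrite tsum_00; simpl; field.
- rewrite X1, Y1 in IH.
  replace (Z.of_nat n + 1)%Z with (Z.of_nat (S n)) in IH by lia.
  rewrite !zpow_nat, Qn2 in IH.
  apply (Cmult_cancel (d1 n * d2 n)); [now apply Cmult_neq_0|].
  transitivity (/ den n); [rewrite <- IH; unfold d1, d2; ring|].
  rewrite den_S; field; auto.
Qed.

Let Y1_closed (n : nat) :
  W (- t ^ 2) (Z.of_nat n) (Z.of_nat n + 1) = / (den n * d1 n).
Proof.
apply (Cmult_cancel (d1 n)); trivial.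
transitivity (/ den n); [|field; auto].
rewrite <- X1_closed, X1; now rewrite zpow_nat.
Qed.

Lemma bailey_G_rel_Q (n : nat) :
  tsum (t ^ 2) 1 (- (1)) (t ^ 3) (Z.of_nat n) (Z.of_nat n + 1)
  = (t ^ 2) ^ n * (1 + t * (t ^ 2) ^ n + t ^ 2)
    / (qpoch (- t) (t ^ 2) (S n) * qpoch (t ^ 4) (t ^ 4) n).
Proof.
fold Q; fold (W (- (1)) (Z.of_nat n) (Z.of_nat n + 1)).
rewrite Ym3, Y1_closed, X1_closed.
replace (Z.of_nat n + 1)%Z with (Z.of_nat (S n)) by lia.
rewrite !zpow_nat, Cpow_S.
replace (qpoch (- t) Q (S n) * qpoch (t ^ 4) (t ^ 4) n) with (den n * d1 n)
  by (unfold den, d1; simpl; ring).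
replace (1 + t * Q ^ n + Q) with (d1 n + Q) by (unfold d1; ring).
field; auto.
Qed.

Lemma bailey_G_rel_1 (n : nat) :
  - t * tsum (t ^ 2) 1 (- / t) (t ^ 3) (Z.of_nat n) (Z.of_nat n)
  = (1 - t * (t ^ 2) ^ n - (t ^ 4) ^ n)
    / (qpoch (- t) (t ^ 2) n * qpoch (t ^ 4) (t ^ 4) n).
Proof.
fold Q; fold (W (- / t) (Z.of_nat n) (Z.of_nat n)); fold (den n).
destruct n as [|n].
- unfold W; simpl Z.of_nat; rewrite tsum_00; unfold den; simpl; field.
- apply (Cmult_cancel (Q ^ S n)); [now apply Cpow_nz|].
  assert (E := Xm5 (Z.of_nat n)).
  replace (Z.of_nat n + 1)%Z with (Z.of_nat (S n)) in E by lia.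
  rewrite zpow_nat in E.
  transitivity (- t * (Q ^ S n * W (- / t) (Z.of_nat (S n)) (Z.of_nat (S n)))); [ring|].
  rewrite E, !X1_closed, den_S.
  replace (/ (den n * (d1 n * d2 n)) - / den n)
    with ((1 - d1 n * d2 n) / (den n * (d1 n * d2 n))) by (field; auto).
  unfold Cdiv; rewrite !Cmult_assoc; apply (f_equal2 Cmult); [|reflexivity].
  unfold d1, d2; rewrite (Cpow_S Q n), (Cpow_S (t ^ 4) n).
  assert (E2 : (t ^ 4) ^ n = Q ^ n * Q ^ n)
    by (unfold Q; rewrite <- Cpow_mult_l; f_equal; ring).
  rewrite E2; unfold Q; ring.
Qed.

End FamilyG.

(** * Limits of complex sequences *)

(** Convergence of a complex sequence. *)
Definition clim (u : nat -> C) (l : C) : Prop :=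
  forall eps : R, (0 < eps)%R ->
  exists N, forall n, (N <= n)%nat -> (Cmod (u n - l) < eps)%R.

Lemma clim_ext (u v : nat -> C) l : (forall n, u n = v n) -> clim u l -> clim v l.
Proof.
intros E H eps He; destruct (H eps He) as [N HN]; exists N; intros n Hn.
rewrite <- E; auto.
Qed.

Lemma clim_const (c : C) : clim (fun _ => c) c.
Proof.
intros eps He; exists 0%nat; intros n _.
replace (c - c) with (RtoC 0) by ring; now rewrite Cmod_0.
Qed.

Lemma clim_subseq (u : nat -> C) l (s : nat -> nat) :
  (forall n, (n <= s n)%nat) -> clim u l -> clim (fun n => u (s n)) l.
Proof.
intros Hs H eps He; destruct (H eps He) as [N HN]; exists N; intros n Hn.
apply HN; generalize (Hs n); lia.
Qed.

Lemma clim_shift (u : nat -> C) l k : clim (fun n => u (n + k)%nat) l -> clim u l.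
Proof.
intros H eps He; destruct (H eps He) as [N HN]; exists (N + k)%nat; intros n Hn.
replace n with (n - k + k)%nat by lia; apply HN; lia.
Qed.

Lemma prefix_bounded (u : nat -> C) N :
  exists M, (0 < M)%R /\ forall n, (n < N)%nat -> (Cmod (u n) <= M)%R.
Proof.
induction N as [|N [M [HM IH]]].
- exists 1%R; split; [lra|intros; lia].
- exists (Rmax M (Cmod (u N))); split; [eapply Rlt_le_trans; [exact HM|apply Rmax_l]|].
  intros n Hn; destruct (Nat.eq_dec n N) as [->|]; [apply Rmax_r|].
  eapply Rle_trans; [apply IH; lia|apply Rmax_l].
Qed.

Lemma clim_bounded (u : nat -> C) l : clim u l ->
  exists M, (0 < M)%R /\ forall n, (Cmod (u n) <= M)%R.
Proof.
intros H; destruct (H 1%R Rlt_0_1) as [N HN].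
destruct (prefix_bounded u N) as [M [HM HP]].
exists (Rmax M (Cmod l + 1)); split; [eapply Rlt_le_trans; [exact HM|apply Rmax_l]|].
intros n; destruct (le_lt_dec N n) as [Hn|Hn].
- eapply Rle_trans; [|apply Rmax_r].
  replace (u n) with (u n - l + l) by ring.
  eapply Rle_trans; [apply Cmod_triangle|]; generalize (HN n Hn); lra.
- eapply Rle_trans; [|apply Rmax_l]; auto.
Qed.

Lemma clim_mult (u v : nat -> C) l m :
  clim u l -> clim v m -> clim (fun n => u n * v n) (l * m).
Proof.
intros Hu Hv eps He.
destruct (clim_bounded u l Hu) as [M [HM HB]].
assert (Hm := Cmod_ge_0 m).
destruct (Hu (eps / (2 * (Cmod m + 1)))%R) as [N1 H1]; [apply Rdiv_lt_0_compat; lra|].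
destruct (Hv (eps / (2 * M))%R) as [N2 H2]; [apply Rdiv_lt_0_compat; lra|].
exists (N1 + N2)%nat; intros n Hn.
replace (u n * v n - l * m) with (u n * (v n - m) + (u n - l) * m) by ring.
eapply Rle_lt_trans; [apply Cmod_triangle|]; rewrite !Cmod_mult.
assert (E1 := H1 n ltac:(lia)); assert (E2 := H2 n ltac:(lia)).
assert (A1 : (Cmod (u n) * Cmod (v n - m) < eps / 2)%R).
{ apply Rle_lt_trans with (M * Cmod (v n - m))%R.
  - apply Rmult_le_compat_r; [apply Cmod_ge_0|auto].
  - apply (Rmult_lt_compat_l M) in E2; trivial.
    replace (M * (eps / (2 * M)))%R with (eps / 2)%R in E2 by (field; lra); lra. }
assert (A2 : (Cmod (u n - l) * Cmod m <= eps / 2)%R).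
{ apply Rle_trans with (eps / (2 * (Cmod m + 1)) * (Cmod m + 1))%R.
  - apply Rmult_le_compat; try apply Cmod_ge_0; lra.
  - right; field; lra. }
lra.
Qed.

Lemma clim_unique (u : nat -> C) l m : clim u l -> clim u m -> l = m.
Proof.
intros Hl Hm.
destruct (Ceq_dec l m) as [|Hn]; trivial; exfalso.
assert (Hd : (0 < Cmod (l - m))%R).
{ apply Cmod_gt_0; intros E; apply Hn.
  replace l with (l - m + m) by ring; rewrite E; ring. }
destruct (Hl (Cmod (l - m) / 2)%R) as [N1 H1]; [lra|].
destruct (Hm (Cmod (l - m) / 2)%R) as [N2 H2]; [lra|].
specialize (H1 (N1 + N2)%nat ltac:(lia)); specialize (H2 (N1 + N2)%nat ltac:(lia)).
assert (H := Cmod_triangle (- (u (N1 + N2)%nat - l)) (u (N1 + N2)%nat - m)).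
rewrite Cmod_opp in H.
replace (- (u (N1 + N2)%nat - l) + (u (N1 + N2)%nat - m)) with (l - m) in H by ring.
lra.
Qed.

Lemma clim_inv (u : nat -> C) l d : (0 < d)%R ->
  (forall n, (d <= Cmod (u n))%R) -> clim u l -> clim (fun n => / u n) (/ l).
Proof.
intros Hd Hb Hu.
assert (Hl : (d <= Cmod l)%R).
{ apply Rnot_lt_le; intros H.
  destruct (Hu (d - Cmod l)%R) as [N HN]; [lra|].
  specialize (HN N (le_n N)); specialize (Hb N).
  assert (T := Cmod_triangle (u N - l) l).
  replace (u N - l + l) with (u N) in T by ring; lra. }
assert (Hl0 : l <> 0) by (apply Cmod_gt_0; lra).
intros eps He; destruct (Hu (eps * (d * d))%R) as [N HN].
{ apply Rmult_lt_0_compat; nra. }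
exists N; intros n Hn; specialize (HN n Hn).
assert (Hn0 : u n <> 0) by (apply Cmod_gt_0; specialize (Hb n); lra).
replace (/ u n - / l) with (- (u n - l) * / (u n * l)) by (field; auto).
rewrite Cmod_mult, Cmod_opp, Cmod_inv, Cmod_mult by (now apply Cmult_neq_0).
specialize (Hb n).
assert (Hp : (d * d <= Cmod (u n) * Cmod l)%R) by (apply Rmult_le_compat; lra).
apply (Rmult_lt_reg_r (Cmod (u n) * Cmod l)); [nra|].
rewrite Rmult_assoc, Rinv_l by nra.
nra.
Qed.

Lemma geometric_clim (u : nat -> C) (K x : R) : (0 <= K)%R -> (0 <= x < 1)%R ->
  (forall n, (Cmod (u (S n) - u n) <= K * x ^ n)%R) -> exists l, clim u l.
Proof.
intros HK Hx Hu.
assert (Hd : forall n m, (Cmod (u (n + m)%nat - u n) <= K * (x ^ n / (1 - x)) * (1 - x ^ m))%R).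
{ intros n m; induction m as [|m IH].
  - rewrite Nat.add_0_r; replace (u n - u n) with (RtoC 0) by ring; rewrite Cmod_0.
    simpl; lra.
  - replace (u (n + S m)%nat - u n)
      with ((u (S (n + m)) - u (n + m)%nat) + (u (n + m)%nat - u n))
      by (rewrite Nat.add_succ_r; ring).
    eapply Rle_trans; [apply Cmod_triangle|].
    eapply Rle_trans; [apply Rplus_le_compat; [apply Hu|apply IH]|].
    right; rewrite pow_add; simpl; field; lra. }
assert (Hc : forall eps : R, (0 < eps)%R -> exists N, forall n m, (N <= n)%nat -> (N <= m)%nat ->
   (Cmod (u n - u m) < eps)%R).
{ intros eps He.
  assert (Hlim := pow_lt_1_zero x ltac:(rewrite Rabs_pos_eq; lra)
     (eps * (1 - x) / (2 * (K + 1)))%R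
     ltac:(apply Rdiv_lt_0_compat; [apply Rmult_lt_0_compat; lra|lra])).
  destruct Hlim as [N HN]; exists N.
  assert (Hs : forall n, (N <= n)%nat -> (Cmod (u n - u N) < eps / 2)%R).
  { intros n Hn; replace n with (N + (n - N))%nat by lia.
    eapply Rle_lt_trans; [apply Hd|].
    specialize (HN N (le_n N)); rewrite Rabs_pos_eq in HN by (apply pow_le; lra).
    assert (P := pow_le x (n - N) ltac:(lra)).
    assert (P' := pow_le x N ltac:(lra)).
    apply Rle_lt_trans with (K * (x ^ N / (1 - x)))%R.
    - rewrite <- (Rmult_1_r (K * (x ^ N / (1 - x)))) at 2.
      apply Rmult_le_compat_l; [|lra].
      apply Rmult_le_pos; trivial; apply Rmult_le_pos; trivial.
      left; apply Rinv_0_lt_compat; lra.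
    - apply (Rmult_lt_reg_r ((1 - x) * 2)); [lra|].
      replace (K * (x ^ N / (1 - x)) * ((1 - x) * 2))%R with (2 * (K * x ^ N))%R by (field; lra).
      apply (Rmult_lt_compat_l (2 * (K + 1))) in HN; [|lra].
      replace (2 * (K + 1) * (eps * (1 - x) / (2 * (K + 1))))%R with (eps * (1 - x))%R in HN
        by (field; lra).
      nra. }
  intros n m Hn Hm.
  replace (u n - u m) with ((u n - u N) + - (u m - u N)) by ring.
  eapply Rle_lt_trans; [apply Cmod_triangle|]; rewrite Cmod_opp.
  specialize (Hs n Hn) as E1; specialize (Hs m Hm) as E2; lra. }
destruct (Rcomplete.R_complete (fun n => fst (u n))) as [a Ha].
{ intros eps He; destruct (Hc eps He) as [N HN]; exists N; intros n m Hn Hm.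
  unfold Rdist; eapply Rle_lt_trans; [|apply (HN n m); lia].
  eapply Rle_trans; [|apply Rmax_Cmod]; apply Rmax_l. }
destruct (Rcomplete.R_complete (fun n => snd (u n))) as [b Hb].
{ intros eps He; destruct (Hc eps He) as [N HN]; exists N; intros n m Hn Hm.
  unfold Rdist; eapply Rle_lt_trans; [|apply (HN n m); lia].
  eapply Rle_trans; [|apply Rmax_Cmod]; apply Rmax_r. }
exists (a, b); intros eps He.
destruct (Ha (eps / 2)%R) as [N1 H1]; [lra|].
destruct (Hb (eps / 2)%R) as [N2 H2]; [lra|].
exists (N1 + N2)%nat; intros n Hn.
specialize (H1 n ltac:(lia)); specialize (H2 n ltac:(lia)); unfold Rdist in *.
eapply Rle_lt_trans; [apply Cmod_2Rmax|].
assert (Hs : (sqrt 2 < 2)%R).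
{ assert (S1 := sqrt_sqrt 2 ltac:(lra)); assert (S2 := sqrt_pos 2); nra. }
assert (Hm : (Rmax (Rabs (fst (u n - (a, b))%C)) (Rabs (snd (u n - (a, b))%C)) < eps / 2)%R)
  by (apply Rmax_lub_lt; trivial).
assert (Hs0 := sqrt_pos 2).
assert (Hm0 : (0 <= Rmax (Rabs (fst (u n - (a, b))%C)) (Rabs (snd (u n - (a, b))%C)))%R)
  by (eapply Rle_trans; [apply Rabs_pos|apply Rmax_l]).
nra.
Qed.

(** * Infinite products *)

(** The finite products are bounded away from 0.  Once
    |a| / (1 - |p|) <= 1/2 this is the inequality of Weierstrass
    |(1-x_1)...(1-x_n)| >= 1 - |x_1| - ... - |x_n|; finitely many factors can be
    split off to reach this case. *)
Lemma qpoch_lower (a p : C) : (Cmod a < 1)%R -> (Cmod p < 1)%R ->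
  exists d, (0 < d)%R /\ forall n, (d <= Cmod (qpoch a p n))%R.
Proof.
intros Ha Hp; set (x := Cmod p) in *.
assert (Hx0 : (0 <= x)%R) by apply Cmod_ge_0.
assert (HK : forall K (a : C), (Cmod a < 1)%R -> (Cmod a * x ^ K / (1 - x) <= / 2)%R ->
  exists d, (0 < d)%R /\ forall n, (d <= Cmod (qpoch a p n))%R).
{ clear a Ha; induction K as [|K IH]; intros a Ha HK.
  - exists (/ 2)%R; split; [lra|].
    simpl in HK; rewrite Rmult_1_r in HK.
    assert (Ha0 := Cmod_ge_0 a).
    assert (H : forall n, (1 - Cmod a / (1 - x) * (1 - x ^ n) <= Cmod (qpoch a p n))%R).
    { induction n as [|n IHn]; simpl.
      - rewrite Cmod_1; lra.
      - rewrite Cmod_mult.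
        assert (Hf : (1 - Cmod a * x ^ n <= Cmod (1 - a * p ^ n))%R).
        { assert (T := Cmod_triangle (1 - a * p ^ n) (a * p ^ n)).
          replace (1 - a * p ^ n + a * p ^ n) with (RtoC 1) in T by ring.
          rewrite Cmod_1, Cmod_mult, Cmod_pow in T; fold x in T; lra. }
        assert (Px := pow_le x n Hx0).
        assert (Px1 : (x ^ n <= 1)%R)
          by (rewrite <- (pow1 n); apply pow_incr; lra).
        set (Y := (Cmod a / (1 - x))%R) in *.
        assert (HY : Cmod a = (Y * (1 - x))%R) by (unfold Y; field; lra).
        assert (HY0 : (0 <= Y)%R) by (apply Rmult_le_pos; [lra|left; apply Rinv_0_lt_compat; lra]).
        clearbody Y; rewrite HY in Hf.
        assert (A1 : (0 <= 1 - Y * (1 - x ^ n))%R) by nra.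
        assert (A2 : (0 <= 1 - Y * (1 - x) * x ^ n)%R).
        { assert (Y * ((1 - x) * x ^ n) <= Y * 1)%R by (apply Rmult_le_compat_l; nra). nra. }
        eapply Rle_trans; [|apply Rmult_le_compat; [exact A1|exact A2|exact IHn|exact Hf]].
        assert (0 <= (Y * (1 - x ^ n)) * (Y * (1 - x) * x ^ n))%R
          by (repeat apply Rmult_le_pos; lra).
        nra. }
    intros n; eapply Rle_trans; [|apply H].
    assert (Px := pow_le x n Hx0).
    assert (HY0 : (0 <= Cmod a / (1 - x))%R)
      by (apply Rmult_le_pos; [lra|left; apply Rinv_0_lt_compat; lra]).
    nra.
  - destruct (IH (a * p)) as [d [Hd H]].
    { apply Cmod_mult_lt; fold x; lra. }
    { rewrite Cmod_mult; fold x; simpl in HK; now rewrite (Rmult_assoc (Cmod a)). }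
    assert (Ha1 : (0 < Cmod (1 - a))%R) by now apply Cmod_gt_0, one_minus_nz.
    exists (Rmin 1 (Cmod (1 - a) * d)); split.
    { apply Rmin_pos; [lra|]; now apply Rmult_lt_0_compat. }
    intros [|n]; [simpl; rewrite Cmod_1; apply Rmin_l|].
    change (S n) with (1 + n)%nat; rewrite qpoch_cat, Cmod_mult.
    eapply Rle_trans; [apply Rmin_r|].
    replace (qpoch a p 1) with (1 - a) by (simpl; ring).
    rewrite Cpow_1_r; apply Rmult_le_compat_l; [lra|apply H]. }
destruct (pow_lt_1_zero x ltac:(rewrite Rabs_pos_eq; lra) ((1 - x) / 2)%R ltac:(lra)) as [K HN].
apply (HK K a Ha).
specialize (HN K (le_n K)); rewrite Rabs_pos_eq in HN by (apply pow_le; lra).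
assert (Px := pow_le x K Hx0); assert (Ha0 := Cmod_ge_0 a).
apply (Rmult_le_reg_r (1 - x)); [lra|].
unfold Rdiv; rewrite Rmult_assoc, Rinv_l by lra; nra.
Qed.

Lemma qpoch_upper (a p : C) : (Cmod p < 1)%R ->
  exists B, (0 < B)%R /\ forall n, (Cmod (qpoch a p n) <= B)%R.
Proof.
intros Hp; set (x := Cmod p) in *.
assert (Hx0 : (0 <= x)%R) by apply Cmod_ge_0.
assert (Ha0 := Cmod_ge_0 a).
set (Y := (Cmod a / (1 - x))%R).
assert (HY : Cmod a = (Y * (1 - x))%R) by (unfold Y; field; lra).
assert (HY0 : (0 <= Y)%R) by (apply Rmult_le_pos; [lra|left; apply Rinv_0_lt_compat; lra]).
exists (exp Y); split; [apply exp_pos|].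
assert (H : forall n, (Cmod (qpoch a p n) <= exp (Y * (1 - x ^ n)))%R).
{ induction n as [|n IH].
  - simpl; rewrite Rminus_diag, Rmult_0_r, exp_0, Cmod_1; lra.
  - simpl qpoch; rewrite Cmod_mult.
    replace (Y * (1 - x ^ S n))%R with (Y * (1 - x ^ n) + Cmod a * x ^ n)%R
      by (rewrite HY; simpl; ring).
    rewrite exp_plus; apply Rmult_le_compat; try apply Cmod_ge_0; trivial.
    eapply Rle_trans; [apply Cmod_triangle|].
    rewrite Cmod_1, Cmod_opp, Cmod_mult, Cmod_pow; fold x.
    apply exp_ineq1_le. }
intros n; eapply Rle_trans; [apply H|].
assert (Px := pow_le x n Hx0).
destruct (Rle_lt_or_eq_dec (Y * (1 - x ^ n)) Y) as [E|E]; [nra| |].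
- left; now apply exp_increasing.
- rewrite E; lra.
Qed.

Lemma qpoch_clim (a p : C) : (Cmod p < 1)%R -> clim (qpoch a p) (qpoch_inf a p).
Proof.
intros Hp; destruct (qpoch_upper a p Hp) as [B [HB HU]].
destruct (geometric_clim (qpoch a p) (B * Cmod a) (Cmod p)) as [l Hl].
- apply Rmult_le_pos; [lra|apply Cmod_ge_0].
- split; [apply Cmod_ge_0|trivial].
- intros n; simpl qpoch.
  replace (qpoch a p n * (1 - a * p ^ n) - qpoch a p n)
    with (- (qpoch a p n * (a * p ^ n))) by ring.
  rewrite Cmod_opp, !Cmod_mult, Cmod_pow, Rmult_assoc.
  apply Rmult_le_compat_r; trivial.
  apply Rmult_le_pos; [apply Cmod_ge_0|apply pow_le, Cmod_ge_0].
- replace (qpoch_inf a p) with l; trivial.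
  symmetry; apply qpoch_inf_unique.
  intros P [eps HP]; destruct (Hl eps (cond_pos eps)) as [N HN].
  exists N; intros n Hn; apply HP.
  apply C_NormedModule_mixin_compat1; exact (HN n Hn).
Qed.

Lemma qpoch_inf_nz (a p : C) : (Cmod a < 1)%R -> (Cmod p < 1)%R -> qpoch_inf a p <> 0.
Proof.
intros Ha Hp E; destruct (qpoch_lower a p Ha Hp) as [d [Hd H]].
assert (L := qpoch_clim a p Hp); rewrite E in L.
destruct (L d Hd) as [N HN]; specialize (HN N (le_n N)); specialize (H N).
replace (qpoch a p N - 0) with (qpoch a p N) in HN by ring; lra.
Qed.

Lemma ip_bounded (p : C) : (Cmod p < 1)%R ->
  exists B, (0 < B)%R /\ forall m, (Cmod (ip p m) <= B)%R.
Proof.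
intros Hp; destruct (qpoch_lower p p Hp Hp) as [d [Hd H]].
assert (Hi := Rinv_0_lt_compat d Hd).
exists (/ d)%R; split; trivial.
intros m; unfold ip; destruct (m <? 0)%Z; [rewrite Cmod_0; lra|].
rewrite Cmod_inv by (apply qpoch_nz; lra).
apply Rinv_le_contravar; trivial.
Qed.

Lemma ip_clim (p : C) (m : nat -> Z) (k : Z) : (Cmod p < 1)%R ->
  (forall n, Z.of_nat n + k <= m n)%Z ->
  clim (fun n => ip p (m n)) (/ qpoch_inf p p).
Proof.
intros Hp Hm; destruct (qpoch_lower p p Hp Hp) as [d [Hd H]].
apply (clim_shift _ _ (Z.to_nat (- k))).
apply (clim_ext (fun n => / qpoch p p (Z.to_nat (m (n + Z.to_nat (- k))%nat)))).
- intros n; specialize (Hm (n + Z.to_nat (- k))%nat); unfold ip.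
  now rewrite (proj2 (Z.ltb_ge _ _)) by lia.
- apply (clim_inv _ _ d); trivial.
  apply (clim_subseq (qpoch p p) _ (fun n => Z.to_nat (m (n + Z.to_nat (- k))%nat))).
  + intros n; specialize (Hm (n + Z.to_nat (- k))%nat); lia.
  + now apply qpoch_clim.
Qed.

(** * Unordered sums *)

(** The real counterpart of [lsum]. *)
Definition rsum {A : Type} (F : list A) (f : A -> R) : R :=
  fold_right Rplus 0%R (map f F).

Lemma rsum_cons {A} (a : A) F (f : A -> R) : (rsum (a :: F) f = f a + rsum F f)%R.
Proof. reflexivity. Qed.

Lemma rsum_app {A} (F G : list A) (f : A -> R) : (rsum (F ++ G) f = rsum F f + rsum G f)%R.
Proof.
induction F as [|a F IH]; [unfold rsum at 2; simpl; ring|].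
simpl app; rewrite !rsum_cons, IH; ring.
Qed.

Lemma rsum_map {A B} (g : A -> B) F (f : B -> R) : rsum (map g F) f = rsum F (fun x => f (g x)).
Proof. unfold rsum; now rewrite map_map. Qed.

Lemma rsum_scal {A} (F : list A) c (f : A -> R) : (rsum F (fun x => c * f x) = c * rsum F f)%R.
Proof.
induction F as [|a F IH]; [unfold rsum; simpl; ring|].
rewrite !rsum_cons, IH; ring.
Qed.

Lemma rsum_nonneg {A} (F : list A) (f : A -> R) : (forall x, 0 <= f x)%R -> (0 <= rsum F f)%R.
Proof.
intros H; induction F as [|a F IH]; [unfold rsum; simpl; lra|].
rewrite rsum_cons; specialize (H a); lra.
Qed.

Lemma rsum_le {A} (F : list A) (f g : A -> R) :
  (forall x, In x F -> f x <= g x)%R -> (rsum F f <= rsum F g)%R.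
Proof.
induction F as [|a F IH]; intros H; [unfold rsum; simpl; lra|].
rewrite !rsum_cons; apply Rplus_le_compat; [apply H; now left|].
apply IH; intros x Hx; apply H; now right.
Qed.

Lemma rsum_incl {A} (F G : list A) (f : A -> R) : (forall x, 0 <= f x)%R ->
  NoDup F -> incl F G -> (rsum F f <= rsum G f)%R.
Proof.
intros Hf; revert G; induction F as [|a F IH]; intros G HF Hi.
- now apply rsum_nonneg.
- inversion HF as [|a' F' Ha HF']; subst.
  destruct (in_split a G) as [G1 [G2 ->]]; [apply Hi; now left|].
  rewrite rsum_app, !rsum_cons.
  specialize (IH (G1 ++ G2) HF').
  rewrite rsum_app in IH.
  assert (rsum F f <= rsum G1 f + rsum G2 f)%R; [|lra].
  apply IH; intros x Hx.
  assert (Hx' : In x (G1 ++ a :: G2)) by (apply Hi; now right).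
  apply in_app_or in Hx'; apply in_or_app; destruct Hx' as [?|[->|?]]; tauto.
Qed.

Lemma Cmod_lsum {A} (F : list A) (f : A -> C) :
  (Cmod (lsum F f) <= rsum F (fun x => Cmod (f x)))%R.
Proof.
induction F as [|a F IH]; [unfold lsum, rsum; simpl; rewrite Cmod_0; lra|].
rewrite lsum_cons, rsum_cons; eapply Rle_trans; [apply Cmod_triangle|lra].
Qed.

(** [has_sum] in terms of the modulus. *)
Definition csum {A : Type} (f : A -> C) (l : C) : Prop :=
  forall eps : R, (0 < eps)%R -> exists F0 : list A,
  forall F, NoDup F -> incl F0 F -> (Cmod (lsum F f - l) < eps)%R.

Lemma csum_has_sum {A} (f : A -> C) l : csum f l -> has_sum f l.
Proof.
intros H P [eps HP]; destruct (H eps (cond_pos eps)) as [F0 HF].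
exists F0; intros F Hn Hi; apply HP.
apply C_NormedModule_mixin_compat1; exact (HF F Hn Hi).
Qed.

Lemma csum_plus {A} (f g : A -> C) l m :
  csum f l -> csum g m -> csum (fun x => f x + g x) (l + m).
Proof.
intros Hf Hg eps He.
destruct (Hf (eps / 2)%R) as [F1 H1]; [lra|].
destruct (Hg (eps / 2)%R) as [F2 H2]; [lra|].
exists (F1 ++ F2); intros F Hn Hi; rewrite lsum_plus.
replace (lsum F f + lsum F g - (l + m)) with ((lsum F f - l) + (lsum F g - m)) by ring.
eapply Rle_lt_trans; [apply Cmod_triangle|].
apply incl_app_inv in Hi; destruct Hi as [Hi1 Hi2].
specialize (H1 F Hn Hi1); specialize (H2 F Hn Hi2); lra.
Qed.

Lemma csum_ext {A} (f g : A -> C) l : (forall x, f x = g x) -> csum f l -> csum g l.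
Proof.
intros E H eps He; destruct (H eps He) as [F0 HF]; exists F0; intros F Hn Hi.
rewrite <- (lsum_ext F f g); auto.
Qed.

(** Absolute summability: the sums of moduli over finite subsets are bounded. *)
Definition summable {A : Type} (f : A -> C) : Prop :=
  exists M : R, forall F, NoDup F -> (rsum F (fun x => Cmod (f x)) <= M)%R.

Lemma summable_tail {A} (f : A -> C) (eps : R) : summable f -> (0 < eps)%R ->
  exists F0, forall F, NoDup F -> (forall x, In x F -> ~ In x F0) ->
  (rsum F (fun x => Cmod (f x)) <= eps)%R.
Proof.
intros [M HM] He.
destruct (completeness (fun s => exists F, NoDup F /\ s = rsum F (fun x => Cmod (f x))))
  as [s [Hub Hlub]].
- exists M; intros s [F [Hn ->]]; auto.
- exists 0%R, []; split; [constructor|reflexivity].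
- assert (H : exists F0, NoDup F0 /\ (s - eps < rsum F0 (fun x => Cmod (f x)))%R).
  { apply NNPP; intros Hno.
    assert (s <= s - eps)%R; [|lra].
    apply Hlub; intros r [F [Hn ->]]; apply Rnot_lt_le; intros Hr.
    apply Hno; now exists F. }
  destruct H as [F0 [Hn0 H0]]; exists F0; intros F Hn Hd.
  assert (H1 : (rsum (F ++ F0) (fun x => Cmod (f x)) <= s)%R).
  { apply Hub; exists (F ++ F0); split; trivial; apply NoDup_app; trivial. }
  rewrite rsum_app in H1; lra.
Qed.

Lemma rsum_clim_0 {A} (w : nat -> A -> C) (f : A -> C) (F : list A) (eps : R) :
  (forall x, clim (fun n => w n x) 0) -> (0 < eps)%R ->
  exists N, forall n, (N <= n)%nat -> (rsum F (fun x => Cmod (w n x * f x)) <= eps)%R.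
Proof.
intros Hw; revert eps; induction F as [|a F IH]; intros eps He.
- exists 0%nat; intros n _; unfold rsum; simpl; lra.
- destruct (IH (eps / 2)%R) as [N HN]; [lra|].
  destruct (clim_mult _ _ _ _ (Hw a) (clim_const (f a)) (eps / 2)%R) as [N' HN']; [lra|].
  exists (N + N')%nat; intros n Hn; rewrite rsum_cons.
  specialize (HN n ltac:(lia)); specialize (HN' n ltac:(lia)).
  replace (w n a * f a - 0 * f a) with (w n a * f a) in HN' by ring; lra.
Qed.

(** Tannery's theorem for a summable family f and bounded weights w_n that
    converge pointwise. *)
Section Tannery.

Context {A : Type} (dec : forall x y : A, {x = y} + {x <> y}).

Let inb (F : list A) (x : A) : bool := if in_dec dec x F then true else false.

Let inb_true F x : inb F x = true <-> In x F.
Proof. unfold inb; destruct (in_dec dec x F); split; auto; discriminate. Qed.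

Let inb_false F x : negb (inb F x) = true <-> ~ In x F.
Proof. unfold inb; destruct (in_dec dec x F); simpl; split; auto; try discriminate; tauto. Qed.

Lemma rsum_filter (p : A -> bool) F (f : A -> R) :
  (rsum F f = rsum (filter p F) f + rsum (filter (fun x => negb (p x)) F) f)%R.
Proof.
induction F as [|a F IH]; [unfold rsum; simpl; ring|].
simpl filter; rewrite rsum_cons, IH; destruct (p a); simpl; rewrite rsum_cons; ring.
Qed.

(** Weights tending to 0 make the weighted sums tend to 0, uniformly in the
    finite set of summation. *)
Lemma tannery_null (f : A -> C) (w : nat -> A -> C) (K eps : R) :
  summable f -> (forall n x, Cmod (w n x) <= K)%R ->
  (forall x, clim (fun n => w n x) 0) -> (0 < eps)%R ->
  exists N, forall n F, (N <= n)%nat -> NoDup F ->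
  (Cmod (lsum F (fun x => w n x * f x)%C) <= eps)%R.
Proof.
intros Hf HK Hw He.
assert (HK' : (0 < Rabs K + 1)%R) by (generalize (Rabs_pos K); lra).
destruct (summable_tail f (eps / (2 * (Rabs K + 1)))%R Hf) as [F0 H0].
{ apply Rdiv_lt_0_compat; lra. }
destruct (rsum_clim_0 w f (nodup dec F0) (eps / 2)%R Hw) as [N HN]; [lra|].
exists N; intros n F Hn HF.
eapply Rle_trans; [apply Cmod_lsum|].
rewrite (rsum_filter (inb F0)).
assert (H1 : (rsum (filter (inb F0) F) (fun x => Cmod (w n x * f x)) <= eps / 2)%R).
{ eapply Rle_trans; [|apply (HN n Hn)].
  apply rsum_incl; [intros; apply Cmod_ge_0|now apply NoDup_filter|].
  intros x Hx; apply filter_In in Hx; apply nodup_In; now apply inb_true. }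
assert (H2 : (rsum (filter (fun x => negb (inb F0 x)) F) (fun x => Cmod (w n x * f x)) <= eps / 2)%R).
{ apply Rle_trans with ((Rabs K + 1) *
     rsum (filter (fun x => negb (inb F0 x)) F) (fun x => Cmod (f x)))%R.
  - rewrite <- rsum_scal; apply rsum_le; intros x _; rewrite Cmod_mult.
    apply Rmult_le_compat_r; [apply Cmod_ge_0|].
    generalize (HK n x) (Rle_abs K); lra.
  - eapply Rle_trans; [apply Rmult_le_compat_l; [lra|apply H0]|].
    + now apply NoDup_filter.
    + intros x Hx; apply filter_In in Hx; now apply inb_false.
    + right; field; lra. }
lra.
Qed.

Variables (f : A -> C) (w : nat -> A -> C) (K : R) (S : nat -> list A).
Hypothesis Hf : summable f.
Hypothesis HK : forall n x, (Cmod (w n x) <= K)%R.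
Hypothesis HS : forall n, NoDup (S n).
Hypothesis Hsupp : forall n x, w n x <> 0 -> In x (S n).

Let Union (F G : list A) := F ++ filter (fun x => negb (inb F x)) G.

Let Union_nodup F G : NoDup F -> NoDup G -> NoDup (Union F G).
Proof.
intros HF HG; apply NoDup_app; trivial; [now apply NoDup_filter|].
intros x Hx Hx'; apply filter_In in Hx'; destruct Hx' as [_ Hx'].
now apply inb_false in Hx'.
Qed.

Let Union_sum n F : NoDup F ->
  lsum (S n) (fun x => w n x * f x) = lsum (Union F (S n)) (fun x => w n x * f x).
Proof.
intros HF; apply lsum_incl; auto.
- intros x Hx; apply in_or_app; destruct (in_dec dec x F) as [|Hn]; auto.
  right; apply filter_In; split; trivial; now apply inb_false.
- intros x _ Hn; destruct (Ceq_dec (w n x) 0) as [->|E]; [ring|].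
  now destruct Hn; apply Hsupp.
Qed.

(** The weights tend to a constant, so their deviation is a null weight. *)
Let deviation (om : C) (eps : R) : (forall x, clim (fun n => w n x) om) -> (0 < eps)%R ->
  exists N, forall n F, (N <= n)%nat -> NoDup F ->
  (Cmod (lsum F (fun x => w n x * f x)%C - om * lsum F f) <= eps)%R.
Proof.
intros Hw He.
destruct (tannery_null f (fun n x => w n x - om) (K + Cmod om) eps Hf) as [N HN]; trivial.
- intros n x; unfold Cminus; eapply Rle_trans; [apply Cmod_triangle|].
  rewrite Cmod_opp; specialize (HK n x); lra.
- intros x eps' He'; destruct (Hw x eps' He') as [N HN]; exists N; intros n Hn.
  replace (w n x - om - 0) with (w n x - om) by ring; auto.
- exists N; intros n F Hn HF; rewrite lsum_sub_scal.
  rewrite <- (lsum_ext F (fun x => (w n x - om) * f x)) by (intros; ring); auto.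
Qed.

(** If the weights tend to 1, a limit of the weighted sums is the sum. *)
Lemma tannery_sum l :
  (forall x, clim (fun n => w n x) 1) ->
  clim (fun n => lsum (S n) (fun x => w n x * f x)) l -> csum f l.
Proof.
intros Hw Hl eps He.
destruct (summable_tail f (eps / 4)%R Hf) as [F0 H0]; [lra|].
destruct (deviation 1 (eps / 4)%R Hw) as [N HN]; [lra|].
destruct (Hl (eps / 4)%R) as [N' HN']; [lra|].
exists F0; intros F HF Hi.
specialize (HN (N + N')%nat (Union F (S (N + N')%nat)) ltac:(lia)
  (Union_nodup _ _ HF (HS _))).
specialize (HN' (N + N')%nat ltac:(lia)); rewrite (Union_sum _ F HF) in HN'.
assert (H1 : (Cmod (lsum (filter (fun x => negb (inb F x)) (S (N + N')%nat)) f) <= eps / 4)%R).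
{ eapply Rle_trans; [apply Cmod_lsum|]; apply H0; [now apply NoDup_filter|].
  intros x Hx Hx'; apply filter_In in Hx; destruct Hx as [_ Hx].
  apply inb_false in Hx; auto. }
set (W := lsum (Union F (S (N + N')%nat)) (fun x => w (N + N')%nat x * f x)) in *.
unfold Union in HN; rewrite lsum_app in HN.
set (T := lsum (filter (fun x => negb (inb F x)) (S (N + N')%nat)) f) in *.
replace (lsum F f - l) with ((W - l) + - (W - 1 * (lsum F f + T)) + - T) by ring.
eapply Rle_lt_trans; [apply Cmod_triangle|]; rewrite Cmod_opp.
assert (H2 := Cmod_triangle (W - l) (- (W - 1 * (lsum F f + T)))).
rewrite Cmod_opp in H2; lra.
Qed.

(** Conversely, if the sum is known, the weighted sums converge to its product
    with the limit of the weights. *)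
Lemma tannery_limit om l :
  (forall x, clim (fun n => w n x) om) -> csum f l ->
  clim (fun n => lsum (S n) (fun x => w n x * f x)) (om * l).
Proof.
intros Hw Hl eps He.
assert (Hom := Cmod_ge_0 om).
destruct (Hl (eps / (2 * (Cmod om + 1)))%R) as [F0 H0]; [apply Rdiv_lt_0_compat; lra|].
destruct (deviation om (eps / 2)%R Hw) as [N HN]; [lra|].
exists N; intros n Hn.
set (F := nodup dec F0).
assert (HF : NoDup F) by apply NoDup_nodup.
assert (HU := Union_nodup F (S n) HF (HS n)).
rewrite (Union_sum n F HF).
specialize (HN n (Union F (S n)) Hn HU).
assert (H1 : (Cmod (lsum (Union F (S n)) f - l) < eps / (2 * (Cmod om + 1)))%R).
{ apply H0; trivial; intros x Hx; apply in_or_app; left; now apply nodup_In. }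
set (W := lsum (Union F (S n)) (fun x => w n x * f x)) in *.
set (T := lsum (Union F (S n)) f) in *.
replace (W - om * l) with ((W - om * T) + om * (T - l)) by ring.
eapply Rle_lt_trans; [apply Cmod_triangle|]; rewrite (Cmod_mult om).
assert (Cmod om * Cmod (T - l) < eps / 2)%R; [|lra].
apply Rle_lt_trans with ((Cmod om + 1/2) * Cmod (T - l))%R.
- apply Rmult_le_compat_r; [apply Cmod_ge_0|lra].
- apply Rlt_le_trans with ((Cmod om + 1/2) * (eps / (2 * (Cmod om + 1))))%R.
  + apply Rmult_lt_compat_l; lra.
  + apply Rle_trans with ((Cmod om + 1) * (eps / (2 * (Cmod om + 1))))%R.
    * apply Rmult_le_compat_r; [left; apply Rdiv_lt_0_compat|]; lra.
    * right; field; lra.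
Qed.

End Tannery.

(** ** Geometric majorants *)

Lemma rsum_geometric (x : R) n : (0 <= x < 1)%R ->
  (rsum (seq 0 n) (fun i => x ^ i) <= / (1 - x))%R.
Proof.
intros Hx.
assert (H : (rsum (seq 0 n) (fun i => x ^ i) = (1 - x ^ n) / (1 - x))%R).
{ induction n as [|n IH]; [unfold rsum; simpl; field; lra|].
  rewrite seq_S, rsum_app, IH; unfold rsum; simpl; field; lra. }
rewrite H; assert (P := pow_le x n ltac:(lra)).
unfold Rdiv; rewrite <- (Rmult_1_l (/ (1 - x))) at 2.
apply Rmult_le_compat_r; [left; apply Rinv_0_lt_compat|]; lra.
Qed.

Lemma rsum_prod {A B} (F : list A) (G : list B) (f : A -> R) (g : B -> R) :
  (rsum (list_prod F G) (fun '(a, b) => f a * g b) = rsum F f * rsum G g)%R.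
Proof.
induction F as [|a F IH]; [unfold rsum; simpl; ring|].
simpl list_prod; rewrite rsum_app, rsum_cons, rsum_map, rsum_scal, IH; ring.
Qed.

Lemma summable_Z (f : Z -> C) (x : R) : (0 <= x < 1)%R ->
  (forall r, Cmod (f r) <= x ^ Z.abs_nat r)%R -> summable f.
Proof.
intros Hx Hf; exists (/ (1 - x) + / (1 - x))%R; intros F HF.
set (n := S (list_max (map Z.abs_nat F))).
eapply Rle_trans; [apply rsum_le; intros r _; apply Hf|].
eapply Rle_trans.
- apply (rsum_incl F (map Z.of_nat (seq 0 n) ++ map (fun k => - Z.of_nat k)%Z (seq 0 n)));
    trivial.
  + intros r; apply pow_le; lra.
  + intros r Hr; apply in_or_app.
    assert (Hn : (Z.abs_nat r < n)%nat).
    { apply Nat.lt_succ_r; generalize (proj1 (list_max_le (map Z.abs_nat F) _) (le_n _)).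
      rewrite Forall_forall; intros H; apply H; now apply in_map. }
    destruct (Z_le_gt_dec 0 r); [left|right]; apply in_map_iff;
      exists (Z.abs_nat r); (split; [lia|apply in_seq; lia]).
- rewrite rsum_app, !rsum_map; apply Rplus_le_compat;
    (eapply Rle_trans; [apply rsum_le|apply (rsum_geometric x n Hx)]);
    intros k _; right; f_equal; lia.
Qed.

Lemma summable_triple (f : nat * nat * nat -> C) (K x : R) : (0 <= x < 1)%R ->
  (forall i j k, Cmod (f (i, j, k)) <= K * x ^ (i + j + k))%R -> summable f.
Proof.
intros Hx Hf.
assert (HK : (0 <= K)%R).
{ eapply Rle_trans; [apply (Cmod_ge_0 (f (0, 0, 0)%nat))|].
  eapply Rle_trans; [apply Hf|simpl; lra]. }
exists (K * (/ (1 - x) * / (1 - x) * / (1 - x)))%R; intros F HF.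
set (n := S (list_max (map (fun '(i, j, k) => i + j + k)%nat F))).
set (g2 := (fun '(i, j) => x ^ i * x ^ j)%R : nat * nat -> R).
set (g := (fun '(ij, k) => g2 ij * x ^ k)%R : nat * nat * nat -> R).
assert (Hi : (0 <= / (1 - x))%R) by (left; apply Rinv_0_lt_compat; lra).
apply Rle_trans with (K * rsum F g)%R.
- rewrite <- rsum_scal; apply rsum_le; intros [[i j] k] _; unfold g, g2.
  rewrite <- !pow_add; apply Hf.
- apply Rmult_le_compat_l; trivial.
  apply Rle_trans with (rsum (list_prod (list_prod (seq 0 n) (seq 0 n)) (seq 0 n)) g).
  + apply rsum_incl; trivial.
    * intros [[i j] k]; unfold g, g2; repeat apply Rmult_le_pos; apply pow_le; lra.
    * intros [[i j] k] Hr.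
      assert (Hn : (i + j + k < n)%nat).
      { apply Nat.lt_succ_r;
          generalize (proj1 (list_max_le (map (fun '(i, j, k) => i + j + k)%nat F) _) (le_n _)).
        rewrite Forall_forall; intros H; apply H.
        now apply (in_map (fun '(i, j, k) => i + j + k)%nat F (i, j, k)). }
      repeat apply in_prod; apply in_seq; lia.
  + unfold g; rewrite (rsum_prod _ _ g2 (fun k => (x ^ k)%R)); unfold g2.
    rewrite (rsum_prod _ _ (fun i => (x ^ i)%R) (fun k => (x ^ k)%R)).
    assert (G := rsum_geometric x n Hx).
    assert (G0 : (0 <= rsum (seq 0 n) (fun i => x ^ i))%R)
      by (apply rsum_nonneg; intros; apply pow_le; lra).
    repeat apply Rmult_le_compat; trivial; now apply Rmult_le_pos.
Qed.

(** * Jacobi's triple product and limits of bilateral sums *)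

Lemma theta_summable (z p : C) : z <> 0 -> p <> 0 -> (Cmod p < 1)%R ->
  (Cmod z < 1)%R -> (Cmod (p / z) < 1)%R -> summable (theta (- z) p).
Proof.
intros Hz Hp Hp1 Hz1 Hpz.
apply (summable_Z _ (Rmax (Cmod z) (Cmod (p / z)))).
{ split; [eapply Rle_trans; [apply (Cmod_ge_0 z)|apply Rmax_l]|now apply Rmax_lub_lt]. }
assert (H : forall (y : C) n, (Cmod (theta y p (Z.of_nat n)) <= Cmod y ^ n)%R).
{ intros y n; unfold theta.
  assert (Ht : (0 <= tri (Z.of_nat n))%Z)
    by (generalize (tri_spec (Z.of_nat n)); nia).
  rewrite <- (Z2Nat.id _ Ht), !zpow_nat, Cmod_mult, Cmod_pow.
  rewrite <- (Rmult_1_r (Cmod y ^ n)) at 2; apply Rmult_le_compat_l.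
  - apply pow_le, Cmod_ge_0.
  - apply Cmod_pow_le; lra. }
intros r; destruct (Z_le_gt_dec 0 r) as [Hr|Hr].
- rewrite <- (Z2Nat.id r) at 1 by lia; eapply Rle_trans; [apply H|].
  rewrite Cmod_opp, Zabs2Nat.abs_nat_nonneg by lia.
  apply pow_incr; split; [apply Cmod_ge_0|apply Rmax_l].
- replace r with (- Z.of_nat (Z.abs_nat r))%Z at 1 by lia.
  rewrite theta_opp by (trivial; now apply Copp_nz).
  eapply Rle_trans; [apply H|].
  replace (p / - z) with (- (p / z)) by (field; trivial).
  rewrite Cmod_opp; apply pow_incr; split; [apply Cmod_ge_0|apply Rmax_r].
Qed.

Lemma ip_pair_supp (Q : C) h a b r : (1 <= h)%Z ->
  ip Q (a - h * r) * ip Q (b + h * r) <> 0 ->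
  In r (zran (- (Z.abs a + Z.abs b)) (Z.abs a + Z.abs b)).
Proof.
intros Hh H; apply in_zran; ip_indices H; nia.
Qed.

(** The weights (p;p)_oo^2 / ((p;p)_(n-r) (p;p)_(n+r)) tend to 1 and turn the
    theta series into the sum in [finite_jtp]. *)
Lemma jacobi_triple (z p : C) : z <> 0 -> p <> 0 -> (Cmod p < 1)%R ->
  (Cmod z < 1)%R -> (Cmod (p / z) < 1)%R ->
  csum (theta (- z) p) (qpoch_inf z p * qpoch_inf (p / z) p * qpoch_inf p p).
Proof.
intros Hz Hp Hp1 Hz1 Hpz.
destruct (ip_bounded p Hp1) as [B [HB HBi]].
set (P := qpoch_inf p p).
assert (HP : P <> 0) by now apply qpoch_inf_nz.
apply (tannery_sum Z.eq_dec (theta (- z) p)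
  (fun n r => P * P * (ip p (Z.of_nat n - 1 * r) * ip p (Z.of_nat n + 1 * r)))
  (Cmod (P * P) * (B * B))
  (fun n => zran (- (Z.abs (Z.of_nat n) + Z.abs (Z.of_nat n)))
                 (Z.abs (Z.of_nat n) + Z.abs (Z.of_nat n)))).
- now apply theta_summable.
- intros n r; rewrite !(Cmod_mult (P * P)), (Cmod_mult (ip _ _)).
  apply Rmult_le_compat_l; [apply Cmod_ge_0|].
  apply Rmult_le_compat; auto using Cmod_ge_0.
- intros; apply nodup_zran.
- intros n r H; apply Cmult_nz_r in H; revert H; apply ip_pair_supp; lia.
- intros r; replace (RtoC 1) with (P * P * (/ P * / P)) by (field; trivial).
  apply clim_mult; [apply clim_const|apply clim_mult].
  + apply (ip_clim p _ (- r)); trivial; lia.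
  + apply (ip_clim p _ r); trivial; lia.
- apply (clim_ext (fun n => P * P * (qpoch z p n * qpoch (p / z) p n * ip p (Z.of_nat (n + n))))).
  + intros n; rewrite <- finite_jtp by trivial; unfold tsum, bsum.
    rewrite <- lsum_scal; apply lsum_ext; intros r _; ring.
  + replace (qpoch_inf z p * qpoch_inf (p / z) p * P)
      with (P * P * (qpoch_inf z p * qpoch_inf (p / z) p * / P)) by (field; trivial).
    apply clim_mult; [apply clim_const|].
    repeat apply clim_mult; try now apply qpoch_clim.
    apply (ip_clim p _ 0); trivial; lia.
Qed.

Lemma tsum_clim (Q z p : C) h s : (Cmod Q < 1)%R -> (1 <= h)%Z ->
  z <> 0 -> p <> 0 -> (Cmod p < 1)%R -> (Cmod z < 1)%R -> (Cmod (p / z) < 1)%R ->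
  clim (fun n => tsum Q h (- z) p (Z.of_nat n) (Z.of_nat n + s))
    (/ qpoch_inf Q Q * / qpoch_inf Q Q
     * (qpoch_inf z p * qpoch_inf (p / z) p * qpoch_inf p p)).
Proof.
intros HQ Hh Hz Hp Hp1 Hz1 Hpz.
destruct (ip_bounded Q HQ) as [B [HB HBi]].
apply (clim_ext (fun n => lsum
   (zran (- (Z.abs (Z.of_nat n) + Z.abs (Z.of_nat n + s)))
         (Z.abs (Z.of_nat n) + Z.abs (Z.of_nat n + s)))
   (fun r => ip Q (Z.of_nat n - h * r) * ip Q (Z.of_nat n + s + h * r) * theta (- z) p r))).
{ intros n; unfold tsum, bsum; apply lsum_ext; intros; ring. }
apply (tannery_limit Z.eq_dec (theta (- z) p)
  (fun n r => ip Q (Z.of_nat n - h * r) * ip Q (Z.of_nat n + s + h * r)) (B * B)).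
- now apply theta_summable.
- intros n r; rewrite Cmod_mult; apply Rmult_le_compat; auto using Cmod_ge_0.
- intros; apply nodup_zran.
- intros n r; now apply ip_pair_supp.
- intros r; apply clim_mult.
  + apply (ip_clim Q _ (- (h * r))); trivial; lia.
  + apply (ip_clim Q _ (s + h * r)); trivial; lia.
- now apply jacobi_triple.
Qed.

(** * Triple sums from the Bailey chain *)

Lemma lsum_prod {A B} (F : list A) (G : list B) (f : A * B -> C) :
  lsum (list_prod F G) f = lsum F (fun a => lsum G (fun b => f (a, b))).
Proof.
induction F as [|a F IH]; [reflexivity|].
simpl list_prod; now rewrite lsum_app, lsum_cons, lsum_map, IH.
Qed.

Lemma nodup_prod {A B} (F : list A) (G : list B) :
  NoDup F -> NoDup G -> NoDup (list_prod F G).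
Proof.
intros HF HG; induction HF as [|a F Ha HF IH]; simpl; [constructor|].
apply NoDup_app; trivial.
- apply nodup_map_inj; trivial; congruence.
- intros [x y] H1 H2; apply in_map_iff in H1; destruct H1 as [z [E _]].
  injection E as <- <-; apply in_prod_iff in H2; tauto.
Qed.

Section Shape.

Variable q : C.
Hypothesis q0 : q <> 0.
Hypothesis q1 : (Cmod q < 1)%R.

Let Q := q ^ 2.

Let Q0 : Q <> 0.
Proof. now apply Cpow_nz. Qed.

Let Q1 : (Cmod Q < 1)%R.
Proof. now apply Cpow_lt_1. Qed.

(** The k-sum, in finite form: [finite_jtp] with n = 0, base q^2 and
    z = -q^(c+1). *)
Lemma euler_finite (c M n : nat) : (M <= n)%nat ->
  lsum (seq 0 (S n)) (fun k => q ^ (k * k + c * k)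
     * (ip Q (Z.of_nat k) * ip Q (Z.of_nat M - Z.of_nat k)))
  = qpoch (- q ^ (c + 1)) Q M * ip Q (Z.of_nat M).
Proof.
intros HM.
assert (Hz : - q ^ (c + 1) <> 0) by now apply Copp_nz, Cpow_nz.
assert (E := finite_jtp (- q ^ (c + 1)) Q M 0 Hz Q0 Q1).
rewrite Nat.add_0_r in E; simpl (qpoch (Q / _) Q 0) in E; rewrite Cmult_1_r in E.
rewrite <- E; unfold tsum; rewrite (bsum_range Q 1 ltac:(lia) _ _ _ 0 (Z.of_nat n))
  by (intros; lia).
rewrite <- lsum_seq_zran; apply lsum_ext; intros k _.
replace (Z.of_nat 0 + 1 * Z.of_nat k)%Z with (Z.of_nat k) by lia.
replace (1 * Z.of_nat k)%Z with (Z.of_nat k) by lia.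
replace (- - q ^ (c + 1)) with (q ^ (c + 1)) by ring.
unfold theta, Q; rewrite <- (zpow_2 q), <- (zpow_nat q (c + 1)), <- !zpow_mul, <- zpow_add,
  <- zpow_nat by trivial.
replace (Z.of_nat (c + 1) * Z.of_nat k + 2 * tri (Z.of_nat k))%Z
  with (Z.of_nat (k * k + c * k)) by (generalize (tri_spec (Z.of_nat k)); lia).
ring.
Qed.

(** The j-sum for given b, weighted so as to be finite.  With N = b + j it is
    the sum over N in two steps of the Bailey chain ([jsum_shift]). *)
Definition jsum (s : nat) (L b : nat) : C :=
  lsum (seq 0 (S L)) (fun j => Q ^ (j * j + (2 * b + s) * j)
     * (ip Q (Z.of_nat j) * ip Q (Z.of_nat L - Z.of_nat b - Z.of_nat j))).

Lemma jsum_zero s L b : (L < b)%nat -> jsum s L b = 0.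
Proof.
intros H; apply lsum_zero; intros j _; rewrite (ip_neg _ (_ - _ - _)) by lia; ring.
Qed.

Lemma jsum_shift s L b :
  zpow Q (Z.of_nat b * Z.of_nat b + Z.of_nat s * Z.of_nat b) * jsum s L b
  = lsum (zran 0 (Z.of_nat L)) (fun N => zpow Q (N * N + Z.of_nat s * N)
      * (ip Q (N - Z.of_nat b) * ip Q (Z.of_nat L - N))).
Proof.
unfold jsum; rewrite <- lsum_scal.
set (g := fun N : Z =>
   zpow Q ((N + Z.of_nat b) * (N + Z.of_nat b) + Z.of_nat s * (N + Z.of_nat b))
      * (ip Q N * ip Q (Z.of_nat L - (N + Z.of_nat b)))).
rewrite (lsum_ext _ _ (fun j => g (Z.of_nat j))).
- rewrite (lsum_seq_zran L g); unfold g.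
  rewrite (zsum_reindex (fun N => N - Z.of_nat b)%Z (fun N => N + Z.of_nat b)%Z
    0 (Z.of_nat L) 0 (Z.of_nat L)).
  + apply lsum_ext; intros N _.
    now replace (N - Z.of_nat b + Z.of_nat b)%Z with N by lia.
  + intros; lia.
  + intros; lia.
  + intros N H; ip_indices H; lia.
  + intros N H; ip_indices H; lia.
- intros j _; unfold g.
  replace (Z.of_nat L - (Z.of_nat j + Z.of_nat b))%Z
    with (Z.of_nat L - Z.of_nat b - Z.of_nat j)%Z by lia.
  rewrite <- zpow_nat, Cmult_assoc, <- zpow_add by trivial.
  do 2 f_equal; lia.
Qed.

Lemma half_sum (h : Z) (y p : C) (s L : nat) : (1 <= h)%Z -> y <> 0 -> p <> 0 ->
  (s <= 1)%nat ->
  lsum (seq 0 (S L)) (fun b =>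
    zpow Q (2 * (Z.of_nat b * Z.of_nat b + Z.of_nat s * Z.of_nat b))
    * tsum Q h y p (Z.of_nat b) (Z.of_nat b + Z.of_nat s) * jsum s L b)
  = tsum Q h (y * zpow Q (h * (h + Z.of_nat s)) * zpow Q (h * (h + Z.of_nat s)))
      (p * zpow Q (2 * h * h) * zpow Q (2 * h * h))
      (Z.of_nat L) (Z.of_nat L + Z.of_nat s).
Proof.
intros Hh Hy Hp Hs.
rewrite <- tsum_chain; trivial; try lia;
  try (apply Cmult_neq_0; trivial; now apply zpow_nz).
set (g := fun b : Z => lsum (zran 0 (Z.of_nat L)) (fun N =>
   zpow Q (b * b + Z.of_nat s * b) * tsum Q h y p b (b + Z.of_nat s) *
   (zpow Q (N * N + Z.of_nat s * N) * (ip Q (N - b) * ip Q (Z.of_nat L - N))))).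
rewrite (lsum_ext _ _ (fun b => g (Z.of_nat b))).
- rewrite (lsum_seq_zran L g); unfold g; rewrite lsum_swap; apply lsum_ext; intros N HN.
  apply in_zran in HN.
  rewrite <- tsum_chain by (trivial; lia).
  rewrite <- lsum_scal.
  rewrite (zsum_range 0 N 0 (Z.of_nat L)).
  + apply lsum_ext; intros; ring.
  + intros b H; assert (Hb : (0 <= b)%Z).
    { destruct (Z_lt_le_dec b 0); trivial.
      destruct (Cmult_nz_r _ _ (Cmult_nz_r _ _ H)); apply bsum_neg; lia. }
    ip_indices H; lia.
  + intros b H; assert (Hb : (0 <= b)%Z).
    { destruct (Z_lt_le_dec b 0); trivial.
      destruct (Cmult_nz_r _ _ (Cmult_nz_r _ _ H)); apply bsum_neg; lia. }
    ip_indices H; lia.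
- intros b _; unfold g; rewrite lsum_scal, <- jsum_shift.
  replace (2 * (Z.of_nat b * Z.of_nat b + Z.of_nat s * Z.of_nat b))%Z
    with ((Z.of_nat b * Z.of_nat b + Z.of_nat s * Z.of_nat b)
       + (Z.of_nat b * Z.of_nat b + Z.of_nat s * Z.of_nat b))%Z by ring.
  rewrite zpow_add by trivial; ring.
Qed.

(** The summand of a triple sum in which i enters the exponents only through
    b = b(i):
    [u_i Q^(j^2+(2b+s)j) q^(k^2+(2b+c)k) / ((Q;Q)_j (Q;Q)_k)]. *)
Definition shape (u : nat -> C) (b : nat -> nat) (s c : nat) : nat * nat * nat -> C :=
  fun '(i, j, k) =>
    u i * (Q ^ (j * j + (2 * b i + s) * j) * ip Q (Z.of_nat j))
        * (q ^ (k * k + (2 * b i + c) * k) * ip Q (Z.of_nat k)).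

Lemma pow_le_decr (x : R) m n : (0 <= x <= 1)%R -> (m <= n)%nat -> (x ^ n <= x ^ m)%R.
Proof.
intros Hx H; replace n with (m + (n - m))%nat by lia; rewrite pow_add.
assert (P := pow_le x m ltac:(lra)).
assert (P' : (x ^ (n - m) <= 1)%R) by (rewrite <- (pow1 (n - m)); apply pow_incr; lra).
nra.
Qed.

Lemma shape_summable u b s c (K : R) :
  (forall i, Cmod (u i) <= K * Cmod q ^ i)%R -> summable (shape u b s c).
Proof.
intros Hu; destruct (ip_bounded Q Q1) as [B [HB HBi]].
assert (Hx := Cmod_ge_0 q).
apply (summable_triple _ (K * B * B) (Cmod q)); [lra|].
intros i j k; unfold shape; rewrite !Cmod_mult.
replace (K * B * B * Cmod q ^ (i + j + k))%R
  with ((K * Cmod q ^ i) * (Cmod q ^ j * B) * (Cmod q ^ k * B))%R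
  by (rewrite !pow_add; ring).
assert (Hj : (Cmod (Q ^ (j * j + (2 * b i + s) * j)) <= Cmod q ^ j)%R).
{ unfold Q; rewrite <- Cpow_mult_r, Cmod_pow; apply pow_le_decr; [lra|nia]. }
assert (Hk : (Cmod (q ^ (k * k + (2 * b i + c) * k)) <= Cmod q ^ k)%R).
{ rewrite Cmod_pow; apply pow_le_decr; [lra|nia]. }
repeat apply Rmult_le_compat; auto using Cmod_ge_0;
  repeat apply Rmult_le_pos; auto using Cmod_ge_0.
Qed.

Lemma triple_dec (x y : nat * nat * nat) : {x = y} + {x <> y}.
Proof. repeat decide equality. Qed.

(** The triple sum over [shape] in closed form, when the coefficients collected
    over the i with the same b(i), called v_b, are given by theta bilateral
    sums.  The weights are
    [(Q;Q)_L / (Q;Q)_(L-b-j) * (Q;Q)_(L-b) / (Q;Q)_(L-b-k)]: taking L - b as the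
    level of the k-sum makes its value (-q^(2b+c+1);Q)_(L-b) the quotient of
    (-q^(c+1);Q)_L, which does not depend on b, by (-q^(c+1);Q)_b. *)
Theorem shape_sum (u v : nat -> C) (b : nat -> nat) (s c : nat) (K : R)
  (h : Z) (y p kappa z z' P : C) :
  (forall i, Cmod (u i) <= K * Cmod q ^ i)%R ->
  (forall i L, (2 * L + 2 <= i)%nat -> (L < b i)%nat) ->
  (forall L (T : nat -> C), (forall n, (L < n)%nat -> T n = 0) ->
     lsum (seq 0 (2 * L + 2)) (fun i => u i * T (b i))
     = lsum (seq 0 (S L)) (fun n => v n * T n)) ->
  (s <= 1)%nat -> (1 <= h)%Z -> y <> 0 -> p <> 0 ->
  (forall n : nat, v n = kappa
     * (zpow Q (2 * (Z.of_nat n * Z.of_nat n + Z.of_nat s * Z.of_nat n))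
        * tsum Q h y p (Z.of_nat n) (Z.of_nat n + Z.of_nat s))
     * qpoch (- q ^ (c + 1)) Q n) ->
  y * zpow Q (h * (h + Z.of_nat s)) * zpow Q (h * (h + Z.of_nat s)) = - z ->
  p * zpow Q (2 * h * h) * zpow Q (2 * h * h) = P ->
  z * z' = P -> (Cmod z < 1)%R -> (Cmod z' < 1)%R ->
  csum (shape u b s c)
    (kappa * qpoch_inf (- q ^ (c + 1)) Q * / qpoch_inf Q Q
     * (qpoch_inf z P * qpoch_inf z' P * qpoch_inf P P)).
Proof.
intros Hu Hb Hreg Hs Hh Hy Hp Hv Ez EP Ezz Hz1 Hz1'.
assert (HP0 : P <> 0).
{ rewrite <- EP; repeat apply Cmult_neq_0; trivial; now apply zpow_nz. }
assert (Hz0 : z <> 0) by (intros E; apply HP0; rewrite <- Ezz, E; ring).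
assert (HP1 : (Cmod P < 1)%R) by (rewrite <- Ezz; apply Cmod_mult_lt; lra).
assert (Ez' : z' = P / z) by (rewrite <- Ezz; field; trivial).
destruct (ip_bounded Q Q1) as [B [HB HBi]].
destruct (qpoch_upper Q Q Q1) as [B' [HB' HBq]].
assert (HQn : forall n, qpoch Q Q n <> 0) by (intros; apply qpoch_nz; lra).
assert (HQi : qpoch_inf Q Q <> 0) by now apply qpoch_inf_nz.
apply (tannery_sum triple_dec (shape u b s c)
  (fun L '(i, j, k) =>
     (qpoch Q Q L * ip Q (Z.of_nat L - Z.of_nat (b i) - Z.of_nat j))
     * (qpoch Q Q (L - b i) * ip Q (Z.of_nat L - Z.of_nat (b i) - Z.of_nat k)))
  ((B' * B) * (B' * B))
  (fun L => list_prod (list_prod (seq 0 (2 * L + 2)) (seq 0 (S L))) (seq 0 (S L)))).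
- now apply (shape_summable u b s c K).
- intros L [[i j] k]; rewrite !Cmod_mult.
  repeat apply Rmult_le_compat; auto using Cmod_ge_0;
    apply Rmult_le_pos; apply Cmod_ge_0.
- intros L; repeat apply nodup_prod; apply seq_NoDup.
- intros L [[i j] k] H; ip_indices H.
  assert (Hi : (i < 2 * L + 2)%nat).
  { destruct (le_lt_dec (2 * L + 2) i) as [Hi|]; trivial.
    apply Hb in Hi; lia. }
  repeat apply in_prod; apply in_seq; lia.
- intros [[i j] k].
  replace (RtoC 1) with ((qpoch_inf Q Q * / qpoch_inf Q Q) * (qpoch_inf Q Q * / qpoch_inf Q Q))
    by (field; trivial).
  repeat apply clim_mult.
  + now apply qpoch_clim.
  + apply (ip_clim Q _ (- Z.of_nat (b i) - Z.of_nat j)); trivial; lia.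
  + apply (clim_shift _ _ (b i)).
    apply (clim_ext (qpoch Q Q)); [|now apply qpoch_clim].
    intros n; f_equal; lia.
  + apply (ip_clim Q _ (- Z.of_nat (b i) - Z.of_nat k)); trivial; lia.
- apply (clim_ext (fun L => qpoch Q Q L * kappa * qpoch (- q ^ (c + 1)) Q L
     * tsum Q h (- z) P (Z.of_nat L) (Z.of_nat L + Z.of_nat s))).
  + intros L; rewrite <- Ez, <- EP, <- half_sum, <- lsum_scal by trivial.
    rewrite lsum_prod, lsum_prod.
    set (T := fun n => qpoch Q Q L * jsum s L n * qpoch (- q ^ (2 * n + c + 1)) Q (L - n)).
    transitivity (lsum (seq 0 (2 * L + 2)) (fun i => u i * T (b i))).
    * rewrite (Hreg L T) by (intros n Hn; unfold T; rewrite jsum_zero by trivial; ring).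
      unfold T; apply lsum_ext; intros n Hn; apply in_seq in Hn; rewrite Hv.
      replace (qpoch (- q ^ (c + 1)) Q L)
        with (qpoch (- q ^ (c + 1)) Q n * qpoch (- q ^ (2 * n + c + 1)) Q (L - n)).
      { ring. }
      replace L with (n + (L - n))%nat at 2 by lia; rewrite qpoch_cat.
      f_equal; f_equal.
      replace (2 * n + c + 1)%nat with (c + 1 + 2 * n)%nat by lia.
      unfold Q; rewrite <- Cpow_mult_r, (Cpow_add_r q (c + 1)); ring.
    * unfold T; apply lsum_ext; intros i _.
      destruct (le_lt_dec (b i) L) as [Hi|Hi].
      -- symmetry.
         rewrite (lsum_ext _ _ (fun j => u i * qpoch Q Q L *
            qpoch (- q ^ (2 * b i + c + 1)) Q (L - b i) *
            (Q ^ (j * j + (2 * b i + s) * j)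
             * (ip Q (Z.of_nat j) * ip Q (Z.of_nat L - Z.of_nat (b i) - Z.of_nat j))))).
         { rewrite lsum_scal; fold (jsum s L (b i)); ring. }
         intros j _.
         rewrite (lsum_ext _ _ (fun k => u i * qpoch Q Q L * qpoch Q Q (L - b i) *
            (Q ^ (j * j + (2 * b i + s) * j)
             * (ip Q (Z.of_nat j) * ip Q (Z.of_nat L - Z.of_nat (b i) - Z.of_nat j)))
            * (q ^ (k * k + (2 * b i + c) * k)
               * (ip Q (Z.of_nat k) * ip Q (Z.of_nat (L - b i) - Z.of_nat k))))).
         { rewrite lsum_scal, euler_finite by lia.
           transitivity (u i * qpoch Q Q L * (qpoch Q Q (L - b i) * ip Q (Z.of_nat (L - b i))) *
            (Q ^ (j * j + (2 * b i + s) * j)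
             * (ip Q (Z.of_nat j) * ip Q (Z.of_nat L - Z.of_nat (b i) - Z.of_nat j)))
             * qpoch (- q ^ (2 * b i + c + 1)) Q (L - b i)); [ring|].
           rewrite qpoch_ip by trivial; ring. }
         intros k _; unfold shape; rewrite Nat2Z.inj_sub by trivial; ring.
      -- rewrite jsum_zero by trivial; symmetry.
         transitivity (RtoC 0); [|ring].
         apply lsum_zero; intros j _; apply lsum_zero; intros k _.
         rewrite (ip_neg _ (_ - _ - Z.of_nat j)) by lia; ring.
  + rewrite Ez'.
    replace (kappa * qpoch_inf (- q ^ (c + 1)) Q * / qpoch_inf Q Q *
       (qpoch_inf z P * qpoch_inf (P / z) P * qpoch_inf P P))
    with (qpoch_inf Q Q * kappa * qpoch_inf (- q ^ (c + 1)) Q *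
       (/ qpoch_inf Q Q * / qpoch_inf Q Q
         * (qpoch_inf z P * qpoch_inf (P / z) P * qpoch_inf P P))) by (field; trivial).
    apply clim_mult; [|apply tsum_clim; trivial; now rewrite <- Ez'].
    apply clim_mult; [|now apply qpoch_clim].
    apply clim_mult; [now apply qpoch_clim|apply clim_const].
Qed.

End Shape.

(** * Product identities *)

Lemma qpoch_S (a p : C) n : qpoch a p (S n) = qpoch a p n * (1 - a * p ^ n).
Proof. reflexivity. Qed.

Lemma qpoch_dissect (a p : C) n :
  qpoch a p (2 * n) = qpoch a (p ^ 2) n * qpoch (a * p) (p ^ 2) n.
Proof.
induction n as [|n IH]; [simpl; ring|].
replace (2 * S n)%nat with (S (S (2 * n))) by lia.
change (qpoch a p (2 * n) * (1 - a * p ^ (2 * n)) * (1 - a * p ^ S (2 * n))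
  = qpoch a (p ^ 2) n * (1 - a * (p ^ 2) ^ n)
    * (qpoch (a * p) (p ^ 2) n * (1 - a * p * (p ^ 2) ^ n))).
rewrite IH, (Cpow_S p (2 * n)), (Cpow_mult_r p 2 n); ring.
Qed.

Lemma qpoch_square (a p : C) n :
  qpoch (a ^ 2) (p ^ 2) n = qpoch a p n * qpoch (- a) p n.
Proof.
induction n as [|n IH]; [simpl; ring|].
rewrite !qpoch_S, IH.
replace ((p ^ 2) ^ n) with (p ^ n * p ^ n); [ring|].
rewrite <- Cpow_mult_l; f_equal; ring.
Qed.

Lemma qpoch_head (a p : C) n : qpoch a p (S n) = (1 - a) * qpoch (a * p) p n.
Proof.
change (S n) with (1 + n)%nat; rewrite qpoch_cat, Cpow_1_r.
f_equal; simpl; ring.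
Qed.

Lemma qpoch_inf_dissect (a p : C) : (Cmod p < 1)%R ->
  qpoch_inf a p = qpoch_inf a (p ^ 2) * qpoch_inf (a * p) (p ^ 2).
Proof.
intros Hp; assert (Hp2 := Cpow_lt_1 p 1 Hp).
apply (clim_unique (fun n => qpoch a p (2 * n))).
- apply (clim_subseq (qpoch a p) _ (fun n => 2 * n)%nat); [lia|now apply qpoch_clim].
- apply (clim_ext (fun n => qpoch a (p ^ 2) n * qpoch (a * p) (p ^ 2) n)).
  + intros n; now rewrite qpoch_dissect.
  + apply clim_mult; now apply qpoch_clim.
Qed.

Lemma qpoch_inf_square (a p : C) : (Cmod p < 1)%R ->
  qpoch_inf (a ^ 2) (p ^ 2) = qpoch_inf a p * qpoch_inf (- a) p.
Proof.
intros Hp; assert (Hp2 := Cpow_lt_1 p 1 Hp).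
apply (clim_unique (qpoch (a ^ 2) (p ^ 2))); [now apply qpoch_clim|].
apply (clim_ext (fun n => qpoch a p n * qpoch (- a) p n)).
- intros n; now rewrite qpoch_square.
- apply clim_mult; now apply qpoch_clim.
Qed.

Lemma qpoch_inf_head (a p : C) : (Cmod p < 1)%R ->
  qpoch_inf a p = (1 - a) * qpoch_inf (a * p) p.
Proof.
intros Hp; apply (clim_unique (fun n => qpoch a p (S n))).
- apply (clim_subseq (qpoch a p) _ S); [lia|now apply qpoch_clim].
- apply (clim_ext (fun n => (1 - a) * qpoch (a * p) p n)).
  + intros n; now rewrite qpoch_head.
  + apply clim_mult; [apply clim_const|now apply qpoch_clim].
Qed.

Section NonzeroBase.

Variable q : C.
Hypothesis q0 : q <> 0.
Hypothesis q1 : (Cmod q < 1)%R.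

Let qn k : q ^ k <> 0.
Proof. now apply Cpow_nz. Qed.

Let qn1 k : (Cmod (q ^ S k) < 1)%R.
Proof. now apply Cpow_lt_1. Qed.

Let q42 : (q ^ 2) ^ 2 = q ^ 4.
Proof. ring. Qed.

Lemma prefactor_mod44 :
  qpoch_inf (- q) (q ^ 2) * / qpoch_inf (q ^ 2) (q ^ 2)
  = / qpochs_inf [q; q ^ 3; q ^ 4] (q ^ 4).
Proof.
unfold qpochs_inf, map, fold_right.
assert (E1 := qpoch_inf_square q (q ^ 2) (qn1 1)).
assert (E2 := qpoch_inf_dissect q (q ^ 2) (qn1 1)).
assert (E3 := qpoch_inf_dissect (q ^ 2) (q ^ 2) (qn1 1)).
rewrite q42 in *.
replace (q * q ^ 2) with (q ^ 3) in E2 by ring.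
replace (q ^ 2 * q ^ 2) with (q ^ 4) in E3 by ring.
assert (N1 : qpoch_inf q (q ^ 2) <> 0) by (apply qpoch_inf_nz; auto).
assert (N2 : qpoch_inf (q ^ 2) (q ^ 4) <> 0) by (apply qpoch_inf_nz; auto).
assert (N3 : qpoch_inf (q ^ 4) (q ^ 4) <> 0) by (apply qpoch_inf_nz; auto).
rewrite E3, E1; rewrite E1 in N2.
transitivity (/ (qpoch_inf q (q ^ 2) * qpoch_inf (q ^ 4) (q ^ 4))).
- field; repeat split; trivial; now apply Cmult_nz_r in N2.
- rewrite E2; apply (f_equal Cinv); ring.
Qed.

Lemma prefactor_mod11 :
  qpoch_inf (- q ^ 2) (q ^ 2) * / qpoch_inf (q ^ 2) (q ^ 2)
  = / qpochs_inf [q ^ 2; q ^ 2; q ^ 4] (q ^ 4).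
Proof.
unfold qpochs_inf, map, fold_right.
assert (E1 := qpoch_inf_square (q ^ 2) (q ^ 2) (qn1 1)).
assert (E3 := qpoch_inf_dissect (q ^ 2) (q ^ 2) (qn1 1)).
rewrite q42 in *.
replace (q ^ 2 * q ^ 2) with (q ^ 4) in E3 by ring.
assert (N2 : qpoch_inf (q ^ 2) (q ^ 4) <> 0) by (apply qpoch_inf_nz; auto).
assert (N3 : qpoch_inf (q ^ 4) (q ^ 4) <> 0) by (apply qpoch_inf_nz; auto).
assert (N4 : qpoch_inf (q ^ 2) (q ^ 2) <> 0) by (apply qpoch_inf_nz; auto).
transitivity (qpoch_inf (q ^ 4) (q ^ 4)
  * / (qpoch_inf (q ^ 2) (q ^ 2) * qpoch_inf (q ^ 2) (q ^ 2))).
- rewrite E1; field; trivial.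
- rewrite E3; field; auto.
Qed.

(** ** The four parts of the two sums *)

Lemma lsum_seq_S n (f : nat -> C) : lsum (seq 0 (S n)) f = lsum (seq 0 n) f + f n.
Proof. rewrite seq_S, lsum_app; unfold lsum at 2; simpl; ring. Qed.

Lemma regroup_even (u : nat -> C) L (T : nat -> C) :
  lsum (seq 0 (2 * L + 2)) (fun i => u i * T (Nat.div2 i))
  = lsum (seq 0 (S L)) (fun n => (u (2 * n)%nat + u (2 * n + 1)%nat) * T n).
Proof.
induction L as [|L IH].
- unfold lsum; simpl; ring.
- replace (2 * S L + 2)%nat with (S (S (2 * L + 2))) by lia.
  rewrite (lsum_seq_S (S L)), (lsum_seq_S (S (2 * L + 2))), (lsum_seq_S (2 * L + 2)), IH.
  replace (2 * L + 2)%nat with (2 * S L)%nat by lia.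
  rewrite Nat.div2_double, Nat.div2_succ_double.
  replace (2 * S L + 1)%nat with (S (2 * S L)) by lia; ring.
Qed.

Lemma regroup_odd (u : nat -> C) L (T : nat -> C) : T (S L) = 0 ->
  lsum (seq 0 (2 * L + 2)) (fun i => u i * T (Nat.div2 (S i)))
  = lsum (seq 0 (S L)) (fun n =>
      (u (2 * n)%nat + match n with O => 0 | S m => u (2 * m + 1)%nat end) * T n).
Proof.
intros H0.
enough (H : lsum (seq 0 (2 * L + 2)) (fun i => u i * T (Nat.div2 (S i)))
  = lsum (seq 0 (S L)) (fun n =>
      (u (2 * n)%nat + match n with O => 0 | S m => u (2 * m + 1)%nat end) * T n)
    + u (2 * L + 1)%nat * T (S L)) by (rewrite H, H0; ring).
clear H0; induction L as [|L IH].
- unfold lsum; simpl; ring.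
- replace (2 * S L + 2)%nat with (S (S (2 * L + 2))) by lia.
  rewrite (lsum_seq_S (S L)), (lsum_seq_S (S (2 * L + 2))), (lsum_seq_S (2 * L + 2)), IH.
  replace (2 * L + 2)%nat with (2 * S L)%nat by lia.
  rewrite Nat.div2_succ_double.
  replace (S (S (2 * S L))) with (2 * S (S L))%nat by lia.
  rewrite Nat.div2_double.
  replace (2 * S L + 1)%nat with (S (2 * S L)) by lia; ring.
Qed.

(** The factors depending on i alone: [uA] and [uB] for the two terms of the
    first sum, [uC] for the second sum. *)
Definition uA (i : nat) : C := q ^ (i * i + i) / qpoch q q i.
Definition uB (i : nat) : C := q ^ (i * i + 3 * i) / qpoch q q i.
Definition uC (i : nat) : C :=
  q ^ (i * i) * (1 + q ^ (i + 1) - q ^ (2 * i)) / qpoch q q i.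

(** [f] at the even and [g] at the odd arguments. *)
Definition par (f g : nat -> C) (i : nat) : C := if Nat.even i then f i else g i.

Lemma par_even f g a : par f g (2 * a) = f (2 * a)%nat.
Proof. unfold par; now rewrite Nat.even_even. Qed.

Lemma par_odd f g a : par f g (2 * a + 1) = g (2 * a + 1)%nat.
Proof. unfold par; now rewrite Nat.even_odd. Qed.

Lemma coef_bound : exists K, (0 <= K)%R /\
  (forall i, Cmod (uA i) <= K * Cmod q ^ i)%R /\
  (forall i, Cmod (uB i) <= K * Cmod q ^ i)%R /\
  (forall i, Cmod (uC i) <= K * Cmod q ^ i)%R.
Proof.
destruct (ip_bounded q q1) as [B [HB HBi]].
assert (Hx := Cmod_ge_0 q).
assert (Hp : forall m n, (n <= m)%nat -> (Cmod (q ^ m) <= Cmod q ^ n)%R).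
{ intros m n H; rewrite Cmod_pow; apply pow_le_decr; [lra|trivial]. }
assert (Hi : forall i, (Cmod (/ qpoch q q i) <= B)%R).
{ intros i; rewrite <- ip_nat; auto. }
exists (3 * B)%R; split; [lra|].
unfold uA, uB, uC, Cdiv; repeat split; intros i; rewrite ?Cmod_mult;
  assert (P := pow_le (Cmod q) i Hx); specialize (Hi i).
- assert (H := Hp (i * i + i)%nat i ltac:(nia)).
  apply Rle_trans with (Cmod q ^ i * B)%R; [|nra].
  apply Rmult_le_compat; auto using Cmod_ge_0.
- assert (H := Hp (i * i + 3 * i)%nat i ltac:(nia)).
  apply Rle_trans with (Cmod q ^ i * B)%R; [|nra].
  apply Rmult_le_compat; auto using Cmod_ge_0.
- assert (H := Hp (i * i)%nat i ltac:(nia)).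
  assert (H3 : (Cmod (1 + q ^ (i + 1) - q ^ (2 * i)) <= 3)%R).
  { unfold Cminus.
    eapply Rle_trans; [apply Cmod_triangle|].
    assert (T := Cmod_triangle 1 (q ^ (i + 1))).
    rewrite Cmod_1 in T; rewrite Cmod_opp.
    assert (H1 := Cmod_pow_le q (i + 1) ltac:(lra)).
    assert (H2 := Cmod_pow_le q (2 * i) ltac:(lra)); lra. }
  replace (3 * B * Cmod q ^ i)%R with (Cmod q ^ i * 3 * B)%R by ring.
  repeat apply Rmult_le_compat; auto using Cmod_ge_0.
  apply Rmult_le_pos; apply Cmod_ge_0.
Qed.

Lemma par_bound (f g : nat -> C) (K : R) :
  (forall i, Cmod (f i) <= K * Cmod q ^ i)%R ->
  (forall i, Cmod (g i) <= K * Cmod q ^ i)%R ->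
  (forall i, Cmod (par f g i) <= K * Cmod q ^ i)%R.
Proof. intros Hf Hg i; unfold par; destruct (Nat.even i); auto. Qed.

Lemma zero_bound (K : R) : (0 <= K)%R -> (forall i : nat, Cmod 0 <= K * Cmod q ^ i)%R.
Proof.
intros HK i; rewrite Cmod_0; apply Rmult_le_pos; trivial.
apply pow_le, Cmod_ge_0.
Qed.

Lemma qpoch_even a : qpoch q q (2 * a) = qpoch q (q ^ 2) a * qpoch (q ^ 2) (q ^ 2) a.
Proof. rewrite qpoch_dissect; now replace (q * q) with (q ^ 2) by ring. Qed.

Lemma qpoch_odd a :
  qpoch q q (2 * a + 1) = qpoch q (q ^ 2) (S a) * qpoch (q ^ 2) (q ^ 2) a.
Proof.
replace (2 * a + 1)%nat with (S (2 * a)) by lia.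
rewrite !qpoch_S, qpoch_even, (Cpow_mult_r q 2 a); ring.
Qed.

Let qz (n : Z) (m : nat) : n = Z.of_nat m -> zpow (q ^ 2) n = q ^ (2 * m).
Proof. intros ->; rewrite zpow_nat; now rewrite (Cpow_mult_r q 2 m). Qed.

(* The pairs of the family G are used with base parameter -q. *)
Let t := - q.

Let t0 : t <> 0.
Proof. now apply Copp_nz. Qed.

Let t1 : (Cmod t < 1)%R.
Proof. unfold t; now rewrite Cmod_opp. Qed.

Let mtt : - t = q.
Proof. unfold t; ring. Qed.

Let t2 : t ^ 2 = q ^ 2.
Proof. unfold t; ring. Qed.

Let t4 : t ^ 4 = q ^ 4.
Proof. unfold t; ring. Qed.

Let nz a n : (Cmod a < 1)%R -> qpoch a (q ^ 2) n <> 0.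
Proof. intros H; apply qpoch_nz; trivial; left; apply qn1. Qed.

Let q4n n : qpoch (q ^ 4) (q ^ 4) n = qpoch (q ^ 2) (q ^ 2) n * qpoch (- q ^ 2) (q ^ 2) n.
Proof. rewrite <- q42; apply qpoch_square. Qed.

Let qodd n : qpoch (q ^ 2) ((q ^ 2) ^ 2) n = qpoch q (q ^ 2) n * qpoch (- q) (q ^ 2) n.
Proof. apply qpoch_square. Qed.

Let mq1 : (Cmod (- q) < 1)%R.
Proof. now rewrite Cmod_opp. Qed.

Let mq21 k : (Cmod (- q ^ S k) < 1)%R.
Proof. rewrite Cmod_opp; apply qn1. Qed.

Let div2_large i L : (2 * L + 2 <= i)%nat -> (L < Nat.div2 i)%nat.
Proof. rewrite Nat.div2_div; intros H; apply Nat.div_le_lower_bound; lia. Qed.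

(** The part of the first sum in which (-q;q^2)_oo appears: the even i = 2b of
    its first term and the odd i = 2b-1 of its second term.  The theta
    coefficients of beta have y = -Q^6 and p = Q^6; the two steps of the chain
    multiply y by Q^8 and p by Q^16, which gives -q^28 and q^44. *)
Lemma first_sum_mod44 :
  csum (shape q (par uA uB) (fun i => Nat.div2 (S i)) 0 0)
    (qpochs_inf [q ^ 16; q ^ 28; q ^ 44] (q ^ 44)
     / qpochs_inf [q; q ^ 3; q ^ 4] (q ^ 4)).
Proof.
destruct coef_bound as [K [HK [HA [HB HC]]]].
replace (qpochs_inf _ _ / _) with
  (1 * qpoch_inf (- q ^ (0 + 1)) (q ^ 2) * / qpoch_inf (q ^ 2) (q ^ 2)
   * (qpoch_inf (q ^ 28) (q ^ 44) * qpoch_inf (q ^ 16) (q ^ 44) * qpoch_inf (q ^ 44) (q ^ 44))).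
2: { unfold Cdiv; rewrite <- prefactor_mod44; simpl (0 + 1)%nat; rewrite Cpow_1_r.
     unfold qpochs_inf, map, fold_right; ring. }
apply (shape_sum q q0 q1 _
  (fun n => par uA uB (2 * n) + match n with O => 0 | S m => par uA uB (2 * m + 1) end)
  _ _ _ K 2 (- (q ^ 2) ^ 6) ((q ^ 2) ^ 6)); trivial.
- now apply par_bound.
- intros i L H; apply div2_large; lia.
- intros L T HT; apply regroup_odd; apply HT; lia.
- lia.
- lia.
- rewrite <- Cpow_mult_r; now apply Copp_nz.
- rewrite <- Cpow_mult_r; apply qn.
- intros n.
  rewrite par_even.
  replace (Z.of_nat n * Z.of_nat n + Z.of_nat 0 * Z.of_nat n)%Z
    with (Z.of_nat n * Z.of_nat n)%Z by lia.
  replace (Z.of_nat n + Z.of_nat 0)%Z with (Z.of_nat n) by lia.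
  assert (E := bailey_C_rel_1 (q ^ 2) (qn 2) (qn1 1) n).
  simpl (0 + 1)%nat; rewrite Cpow_1_r, (qz _ (2 * n * n)) by lia.
  rewrite qodd in E.
  apply (Cmult_cancel (q ^ 2)); trivial.
  transitivity (q ^ (2 * (2 * n * n)) * qpoch (- q) (q ^ 2) n
     * (q ^ 2 * tsum (q ^ 2) 2 (- (q ^ 2) ^ 6) ((q ^ 2) ^ 6) (Z.of_nat n) (Z.of_nat n))); [|ring].
  rewrite E.
  assert (N1 := nz q n q1); assert (N2 := nz (- q) n mq1).
  assert (N3 := nz (q ^ 2) n (qn1 1)).
  destruct n as [|m].
  { unfold uA; simpl; field. }
  rewrite par_odd; unfold uA, uB; rewrite qpoch_even, qpoch_odd.
  assert (N4 := nz (q ^ 2) m (qn1 1)).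
  assert (N5 : 1 - q ^ 2 * q ^ (2 * m) <> 0)
    by (rewrite <- Cpow_add_r; apply one_minus_nz, qn1).
  rewrite (qpoch_S (q ^ 2)), <- !(Cpow_mult_r q 2).
  set (G := q ^ (4 * m * m + 8 * m + 4)); set (H := q ^ (2 * m)) in *.
  assert (F1 : q ^ (2 * S m * (2 * S m) + 2 * S m) = G * H * q ^ 2)
    by (unfold G, H; rewrite <- !Cpow_add_r; f_equal; lia).
  assert (F2 : q ^ ((2 * m + 1) * (2 * m + 1) + 3 * (2 * m + 1)) = G * H)
    by (unfold G, H; rewrite <- !Cpow_add_r; f_equal; lia).
  assert (F3 : q ^ (2 * (2 * S m * S m)) = G) by (unfold G; f_equal; lia).
  assert (F4 : q ^ (2 * S m) = H * q ^ 2)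
    by (unfold H; rewrite <- !Cpow_add_r; f_equal; lia).
  assert (F5 : q ^ (2 * (S m + 1)) = H * q ^ 4)
    by (unfold H; rewrite <- !Cpow_add_r; f_equal; lia).
  assert (F6 : q ^ (2 * (2 * S m)) = H * H * q ^ 4)
    by (unfold H; rewrite <- !Cpow_add_r; f_equal; lia).
  rewrite F1, F2, F3, F4, F5, F6; field; auto.
- simpl; ring.
- simpl; ring.
- ring.
Qed.

(** The part of the first sum in which (-q^2;q^2)_oo appears: i = 2b+1 in its
    first term and i = 2b in its second term. *)
Lemma first_sum_mod11 :
  csum (shape q (par uB uA) Nat.div2 1 1)
    (qpochs_inf [- q ^ 3; q ^ 8; - q ^ 11] (- q ^ 11)
     / qpochs_inf [q ^ 2; q ^ 2; q ^ 4] (q ^ 4)).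
Proof.
destruct coef_bound as [K [HK [HA [HB HC]]]].
replace (qpochs_inf _ _ / _) with
  (1 * qpoch_inf (- q ^ (1 + 1)) (q ^ 2) * / qpoch_inf (q ^ 2) (q ^ 2)
   * (qpoch_inf (q ^ 8) (- q ^ 11) * qpoch_inf (- q ^ 3) (- q ^ 11)
      * qpoch_inf (- q ^ 11) (- q ^ 11))).
2: { unfold Cdiv; rewrite <- prefactor_mod11; simpl (1 + 1)%nat.
     unfold qpochs_inf, map, fold_right; ring. }
apply (shape_sum q q0 q1 _ (fun n => par uB uA (2 * n) + par uB uA (2 * n + 1))
  _ _ _ K 1 (- (1)) (t ^ 3)); trivial.
- now apply par_bound.
- intros L T _; apply regroup_even.
- lia.
- apply Copp_nz, C1_nz.
- now apply Cpow_nz.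
- intros n; rewrite par_even, par_odd; unfold uA, uB; rewrite qpoch_even, qpoch_odd.
  assert (E := bailey_G_rel_Q t t0 t1 n).
  rewrite mtt, t2, t4, q4n in E; simpl (Z.of_nat 1); rewrite E.
  rewrite (qz _ (2 * (n * n + n))) by lia.
  assert (N1 := nz q n q1); assert (N2 := nz (- q ^ 2) n (mq21 1)).
  assert (N3 := nz (q ^ 2) n (qn1 1)).
  simpl (1 + 1)%nat; rewrite (qpoch_S q), <- !(Cpow_mult_r q 2).
  assert (N4 : 1 - q * q ^ (2 * n) <> 0) by (rewrite <- Cpow_S; apply one_minus_nz, qn1).
  set (G := q ^ (4 * n * n + 4 * n)); set (H := q ^ (2 * n)) in *.
  assert (F1 : q ^ (2 * n * (2 * n) + 3 * (2 * n)) = G * H)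
    by (unfold G, H; rewrite <- !Cpow_add_r; f_equal; lia).
  assert (F2 : q ^ ((2 * n + 1) * (2 * n + 1) + (2 * n + 1)) = G * H * q ^ 2)
    by (unfold G, H; rewrite <- !Cpow_add_r; f_equal; lia).
  assert (F3 : q ^ (2 * (2 * (n * n + n))) = G) by (unfold G; f_equal; lia).
  rewrite F1, F2, F3; unfold t; field; auto.
- simpl; ring.
- unfold t; simpl; ring.
- ring.
Qed.

(** The odd i of the second sum.  Here c = 2, and the constant q (1 + q) makes
    up for (-q^3;q^2)_oo = (-q;q^2)_oo / (1 + q). *)
Lemma second_sum_mod44 :
  csum (shape q (par (fun _ => 0) uC) Nat.div2 1 2)
    (q * (qpochs_inf [q ^ 16; q ^ 28; q ^ 44] (q ^ 44)
          / qpochs_inf [q; q ^ 3; q ^ 4] (q ^ 4))).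
Proof.
destruct coef_bound as [K [HK [HA [HB HC]]]].
replace (q * (qpochs_inf _ _ / _)) with
  (q * (1 + q) * qpoch_inf (- q ^ (2 + 1)) (q ^ 2) * / qpoch_inf (q ^ 2) (q ^ 2)
   * (qpoch_inf (q ^ 28) (q ^ 44) * qpoch_inf (q ^ 16) (q ^ 44) * qpoch_inf (q ^ 44) (q ^ 44))).
2: { unfold Cdiv; rewrite <- prefactor_mod44, (qpoch_inf_head (- q)) by apply qn1.
     replace (- q * q ^ 2) with (- q ^ 3) by ring; simpl (2 + 1)%nat.
     unfold qpochs_inf, map, fold_right; ring. }
apply (shape_sum q q0 q1 _
  (fun n => par (fun _ => 0) uC (2 * n) + par (fun _ => 0) uC (2 * n + 1))
  _ _ _ K 2 (- (q ^ 2) ^ 2) ((q ^ 2) ^ 6)); trivial.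
- apply par_bound; trivial; now apply zero_bound.
- intros L T _; apply regroup_even.
- lia.
- rewrite <- Cpow_mult_r; now apply Copp_nz.
- rewrite <- Cpow_mult_r; apply qn.
- intros n; rewrite par_even, par_odd; unfold uC; rewrite qpoch_odd.
  assert (E := bailey_C_rel_Q (q ^ 2) (qn 2) (qn1 1) n).
  rewrite qodd in E; simpl (Z.of_nat 1); rewrite E.
  rewrite (qz _ (2 * (n * n + n))) by lia.
  rewrite (qpoch_head (- q)).
  replace (- q * q ^ 2) with (- q ^ 3) by ring.
  assert (N1 := nz q (S n) q1); assert (N2 := nz (- q ^ 3) n (mq21 2)).
  assert (N3 := nz (q ^ 2) n (qn1 1)).
  assert (N4 := one_minus_nz (- q) mq1).
  simpl (2 + 1)%nat; rewrite <- !(Cpow_mult_r q 2).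
  set (G := q ^ (4 * n * n + 4 * n)); set (H := q ^ (2 * n)).
  assert (F1 : q ^ ((2 * n + 1) * (2 * n + 1)) = G * q)
    by (unfold G; rewrite <- (Cpow_1_r q) at 3; rewrite <- !Cpow_add_r; f_equal; lia).
  assert (F2 : q ^ (2 * n + 1 + 1) = H * q ^ 2)
    by (unfold H; rewrite <- !Cpow_add_r; f_equal; lia).
  assert (F3 : q ^ (2 * (2 * (n * n + n))) = G) by (unfold G; f_equal; lia).
  assert (F4 : q ^ (2 * (2 * n + 1)) = H * H * q ^ 2)
    by (unfold H; rewrite <- !Cpow_add_r; f_equal; lia).
  assert (F5 : q ^ (2 * (n + 1)) = H * q ^ 2)
    by (unfold H; rewrite <- !Cpow_add_r; f_equal; lia).
  rewrite F1, F2, F3, F4, F5; field; auto.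
- simpl; ring.
- simpl; ring.
- ring.
Qed.

(** The even i of the second sum. *)
Lemma second_sum_mod11 :
  csum (shape q (par uC (fun _ => 0)) Nat.div2 0 1)
    (q * (qpochs_inf [- q ^ 3; q ^ 8; - q ^ 11] (- q ^ 11)
          / qpochs_inf [q ^ 2; q ^ 2; q ^ 4] (q ^ 4))).
Proof.
destruct coef_bound as [K [HK [HA [HB HC]]]].
replace (q * (qpochs_inf _ _ / _)) with
  (q * qpoch_inf (- q ^ (1 + 1)) (q ^ 2) * / qpoch_inf (q ^ 2) (q ^ 2)
   * (qpoch_inf (- q ^ 3) (- q ^ 11) * qpoch_inf (q ^ 8) (- q ^ 11)
      * qpoch_inf (- q ^ 11) (- q ^ 11))).
2: { unfold Cdiv; rewrite <- prefactor_mod11; simpl (1 + 1)%nat.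
     unfold qpochs_inf, map, fold_right; ring. }
apply (shape_sum q q0 q1 _
  (fun n => par uC (fun _ => 0) (2 * n) + par uC (fun _ => 0) (2 * n + 1))
  _ _ _ K 1 (- / t) (t ^ 3)); trivial.
- apply par_bound; trivial; now apply zero_bound.
- intros L T _; apply regroup_even.
- lia.
- lia.
- now apply Copp_nz, Cinv_nz.
- now apply Cpow_nz.
- intros n; rewrite par_even, par_odd; unfold uC; rewrite qpoch_even.
  assert (E := bailey_G_rel_1 t t0 t1 n).
  rewrite mtt, t2, t4, q4n in E.
  replace (Z.of_nat n + Z.of_nat 0)%Z with (Z.of_nat n) by lia.
  rewrite (qz _ (2 * (n * n))) by lia.
  simpl (1 + 1)%nat.
  transitivity (q ^ (2 * (2 * (n * n))) * qpoch (- q ^ 2) (q ^ 2) n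
    * (q * tsum (q ^ 2) 1 (- / t) (t ^ 3) (Z.of_nat n) (Z.of_nat n))); [|ring].
  rewrite E.
  assert (N1 := nz q n q1); assert (N2 := nz (- q ^ 2) n (mq21 1)).
  assert (N3 := nz (q ^ 2) n (qn1 1)).
  rewrite <- !(Cpow_mult_r q).
  set (G := q ^ (4 * n * n)); set (H := q ^ (2 * n)).
  assert (F1 : q ^ (2 * n * (2 * n)) = G) by (unfold G; f_equal; lia).
  assert (F2 : q ^ (2 * n + 1) = H * q)
    by (unfold H; rewrite <- (Cpow_1_r q) at 3; rewrite <- !Cpow_add_r; f_equal; lia).
  assert (F3 : q ^ (2 * (2 * (n * n))) = G) by (unfold G; f_equal; lia).
  assert (F4 : q ^ (2 * (2 * n)) = q ^ (4 * n)) by (f_equal; lia).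
  rewrite F1, F2, F3, F4; unfold t; field; auto.
- unfold t; simpl; field; trivial.
- unfold t; simpl; ring.
- ring.
Qed.

(** ** Splitting the summands by parity *)

Lemma summand_first i j k :
  shape q (par uB uA) Nat.div2 1 1 (i, j, k)
  + shape q (par uA uB) (fun i => Nat.div2 (S i)) 0 0 (i, j, k)
  = q ^ (i ^ 2 + 2 * j ^ 2 + k ^ 2 + 2 * i * j + i * k + i)
      * (1 + q ^ (2 * i + 2 * j + k))
    / (qpoch q q i * qpoch (q ^ 2) (q ^ 2) j * qpoch (q ^ 2) (q ^ 2) k).
Proof.
unfold shape; rewrite !ip_nat, <- !(Cpow_mult_r q 2), !Nat.pow_2_r.
assert (N1 : qpoch q q i <> 0) by (apply qpoch_nz; lra).
assert (N2 := nz (q ^ 2) j (qn1 1)); assert (N3 := nz (q ^ 2) k (qn1 1)).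
set (E := (i * i + 2 * (j * j) + k * k + 2 * i * j + i * k + i)%nat).
set (F := (2 * i + 2 * j + k)%nat).
set (D := qpoch q q i * qpoch (q ^ 2) (q ^ 2) j * qpoch (q ^ 2) (q ^ 2) k).
transitivity (q ^ (E + F) / D + q ^ E / D);
  [|rewrite Cpow_add_r; unfold D; field; auto].
destruct (Nat.Even_or_Odd i) as [[a Ea]|[a Ea]].
- rewrite Ea at 1 2 4 5; rewrite !par_even, <- Ea.
  replace (Nat.div2 i) with a by (rewrite Ea; symmetry; apply Nat.div2_double).
  replace (Nat.div2 (S i)) with a by (rewrite Ea; symmetry; apply Nat.div2_succ_double).
  replace (E + F)%nat with ((i * i + 3 * i) + 2 * (j * j + (2 * a + 1) * j)
     + (k * k + (2 * a + 1) * k))%nat by (unfold E, F; subst i; ring).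
  replace E with ((i * i + i) + 2 * (j * j + (2 * a + 0) * j)
     + (k * k + (2 * a + 0) * k))%nat by (unfold E; subst i; ring).
  unfold uA, uB, D; rewrite !Cpow_add_r; field; auto.
- rewrite Ea at 1 2 4 5; rewrite !par_odd, <- Ea.
  replace (Nat.div2 i) with a
    by (rewrite Ea, Nat.add_1_r; symmetry; apply Nat.div2_succ_double).
  replace (Nat.div2 (S i)) with (S a)
    by (rewrite Ea; replace (S (2 * a + 1)) with (2 * S a)%nat by lia;
        symmetry; apply Nat.div2_double).
  replace (E + F)%nat with ((i * i + 3 * i) + 2 * (j * j + (2 * S a + 0) * j)
     + (k * k + (2 * S a + 0) * k))%nat by (unfold E, F; subst i; ring).
  replace E with ((i * i + i) + 2 * (j * j + (2 * a + 1) * j)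
     + (k * k + (2 * a + 1) * k))%nat by (unfold E; subst i; ring).
  unfold uA, uB, D; rewrite !Cpow_add_r; field; auto.
Qed.

Lemma summand_second i j k :
  shape q (par uC (fun _ => 0)) Nat.div2 0 1 (i, j, k)
  + shape q (par (fun _ => 0) uC) Nat.div2 1 2 (i, j, k)
  = q ^ (i ^ 2 + 2 * j ^ 2 + k ^ 2 + 2 * i * j + i * k + k)
      * (1 + q ^ (i + 1) - q ^ (2 * i))
    / (qpoch q q i * qpoch (q ^ 2) (q ^ 2) j * qpoch (q ^ 2) (q ^ 2) k).
Proof.
unfold shape; rewrite !ip_nat, <- !(Cpow_mult_r q 2 (_ * _ + _)), !Nat.pow_2_r.
assert (N1 : qpoch q q i <> 0) by (apply qpoch_nz; lra).
assert (N2 := nz (q ^ 2) j (qn1 1)); assert (N3 := nz (q ^ 2) k (qn1 1)).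
set (E := (i * i + 2 * (j * j) + k * k + 2 * i * j + i * k + k)%nat).
destruct (Nat.Even_or_Odd i) as [[a Ea]|[a Ea]].
- rewrite Ea at 1 4; rewrite !par_even, <- Ea.
  replace (Nat.div2 i) with a by (rewrite Ea; symmetry; apply Nat.div2_double).
  replace E with ((i * i) + 2 * (j * j + (2 * a + 0) * j)
     + (k * k + (2 * a + 1) * k))%nat by (unfold E; subst i; ring).
  unfold uC; rewrite (Cpow_add_r q (i * i + _)), (Cpow_add_r q (i * i)); field; auto.
- rewrite Ea at 1 4; rewrite !par_odd, <- Ea.
  replace (Nat.div2 i) with a
    by (rewrite Ea, Nat.add_1_r; symmetry; apply Nat.div2_succ_double).
  replace E with ((i * i) + 2 * (j * j + (2 * a + 1) * j)
     + (k * k + (2 * a + 2) * k))%nat by (unfold E; subst i; ring).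
  unfold uC; rewrite (Cpow_add_r q (i * i + _)), (Cpow_add_r q (i * i)); field; auto.
Qed.

End NonzeroBase.

(** * The case q = 0 *)

Lemma csum_single {A : Type} (a : A) (f : A -> C) l :
  (forall x, x <> a -> f x = 0) -> f a = l -> csum f l.
Proof.
intros H <- eps He; exists [a]; intros F HF Hi.
rewrite <- (lsum_incl [a] F f); trivial.
- replace (lsum [a] f - f a) with (RtoC 0) by (unfold lsum; simpl; ring).
  now rewrite Cmod_0.
- constructor; [intros []|constructor].
- intros x _ Hx; apply H; intros ->; apply Hx; now left.
Qed.

Lemma qpoch_inf_zero (a p : C) : a = 0 -> qpoch_inf a p = 1.
Proof.
intros ->; apply qpoch_inf_unique.
intros P [eps HP]; exists 0%nat; intros n _; apply HP.
replace (qpoch 0 p n) with (RtoC 1); [apply ball_center|].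
induction n as [|n IH]; simpl; [trivial|rewrite <- IH; ring].
Qed.

Lemma Cpow_0_l n : (0 < n)%nat -> 0 ^ n = 0.
Proof. intros H; destruct n as [|n]; [lia|]; rewrite Cpow_S; ring. Qed.

Theorem theorem1p2 (q : C) (hq : (Cmod q < 1)%R) :
  has_sum
    (fun '((i, j, k) : nat * nat * nat) =>
       q ^ (i ^ 2 + 2 * j ^ 2 + k ^ 2 + 2 * i * j + i * k + i)
         * (1 + q ^ (2 * i + 2 * j + k))
       / (qpoch q q i * qpoch (q ^ 2) (q ^ 2) j * qpoch (q ^ 2) (q ^ 2) k))
    (qpochs_inf [- q ^ 3; q ^ 8; - q ^ 11] (- q ^ 11)
       / qpochs_inf [q ^ 2; q ^ 2; q ^ 4] (q ^ 4)
     + qpochs_inf [q ^ 16; q ^ 28; q ^ 44] (q ^ 44)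
       / qpochs_inf [q; q ^ 3; q ^ 4] (q ^ 4))
  /\
  has_sum
    (fun '((i, j, k) : nat * nat * nat) =>
       q ^ (i ^ 2 + 2 * j ^ 2 + k ^ 2 + 2 * i * j + i * k + k)
         * (1 + q ^ (i + 1) - q ^ (2 * i))
       / (qpoch q q i * qpoch (q ^ 2) (q ^ 2) j * qpoch (q ^ 2) (q ^ 2) k))
    (q * (qpochs_inf [- q ^ 3; q ^ 8; - q ^ 11] (- q ^ 11)
            / qpochs_inf [q ^ 2; q ^ 2; q ^ 4] (q ^ 4))
     + q * (qpochs_inf [q ^ 16; q ^ 28; q ^ 44] (q ^ 44)
              / qpochs_inf [q; q ^ 3; q ^ 4] (q ^ 4))).
Proof.
destruct (Ceq_dec q 0) as [->|q0].
- clear hq; unfold qpochs_inf, map, fold_right.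
  rewrite !qpoch_inf_zero by (rewrite ?Cpow_0_l by lia; ring).
  split; apply csum_has_sum.
  + apply (csum_single (0, 0, 0)%nat); [|simpl; field].
    intros [[i j] k] Hne.
    rewrite Cpow_0_l; [unfold Cdiv; ring|].
    rewrite !Nat.pow_2_r; destruct i, j, k; try lia; now destruct Hne.
  + apply (csum_single (0, 0, 0)%nat); [|simpl; field].
    intros [[i j] k] Hne.
    rewrite Cpow_0_l; [unfold Cdiv; ring|].
    rewrite !Nat.pow_2_r; destruct i, j, k; try lia; now destruct Hne.
- split; apply csum_has_sum.
  + eapply csum_ext; [|apply csum_plus;
      [now apply first_sum_mod11|now apply first_sum_mod44]].
    intros [[i j] k]; now apply summand_first.
  + eapply csum_ext; [|apply csum_plus;
      [now apply second_sum_mod11|now apply second_sum_mod44]].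
    intros [[i j] k]; now apply summand_second.
Qed.
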